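(* Consider two stochastic (SISO) LTI dynamical systems with state-space models $\Sigma_i(\theta_i)=(A_i(\theta_i),B_i(\theta_i),C_i(\theta_i))$, $i\in\{1,2\}$, and corresponding random transfer functions $P_i(\theta_i;s)=C_i(\theta_i)(sI-A_i(\theta_i))^{-1}B_i(\theta_i)$, where the random parameter $\theta_i$ is governed by the distribution $\mathbf f_{\theta_i}$. Let $\mathbb{P}_{R_i(\omega)}$ be the push-forward of $\mathbf f_{\theta_i}$ under $\theta_i\mapsto\phi^{-1}(P_i(\theta_i;j\omega))$, which governs the uncertainty of system $i$ on the Riemann sphere, and let $\mathbf f_i=(\Phi_i)_\#\mathbf f_{\theta_i}$ be the distribution governing the uncertainty of $\Sigma_i(\theta_i)$. Then for $q\ge1$, $$\mathrm{d}_q(P_1,P_2)\ \le\ \mathrm{dist}^{q}_{\Sigma_1,\Sigma_2,\delta_g}.$$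
   Context: State-space models: $A_i(\theta_i)\in\mathbb{R}^{n\times n}$, $B_i(\theta_i)\in\mathbb{R}^{n\times m}$, $C_i(\theta_i)\in\mathbb{R}^{l\times n}$ with $m=l=1$ (SISO), describing $\dot x=Ax+Bu$, $y=Cx$; the space of models is viewed inside $\mathbb{R}^{n^2+nm+ln}$. The measurable map $\Phi_i$ sends the parameter $\theta_i\in\Theta_i\subseteq\mathbb{R}^p$ to $\Sigma_i(\theta_i)$ (the paper's standing choice for $\mathbf f_{\theta_i}$ is Gaussian, $\mathcal N(\mu_{\theta_i},\Sigma_{\theta_i})$). $\mathbf{TF}$ maps a model $(A,B,C)$ to its transfer function $C(sI-A)^{-1}B$, assumed to lie in $\mathbf{R}\mathcal{L}_\infty$ (real rational functions essentially bounded on the imaginary axis), and $\mathcal{E}_\omega(P)=P(j\omega)$. Standing assumption: for each $\omega\in\Omega=[0,\infty)$, the map $\Psi^{\mathfrak R}_\omega=\phi^{-1}\circ\mathcal{E}_\omega\circ\mathbf{TF}$ from the space of models to the Riemann sphere is continuous. Frequency-domain distance: the Riemann sphere is $\partial\mathfrak{R} = \{(x,y,z)\in\mathbb{R}^3 : x^2+y^2+(z-\tfrac12)^2=\tfrac14\}$, the inverse stereographic projection $\phi^{-1}:\mathbb{C}\to\partial\mathfrak{R}$ is $$\phi^{-1}(c) = \left(\frac{\mathrm{Re}(c)}{1+|c|^2},\frac{\mathrm{Im}(c)}{1+|c|^2},\frac{|c|^2}{1+|c|^2}\right),$$ and $\mathrm{d_{chord}}(r_1,r_2)=\|r_1-r_2\|$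 (Euclidean norm in $\mathbb{R}^3$). For each $\omega$, the distribution of $P_i(\theta_i;j\omega)$ on $\mathbb{C}$ has support $\mathcal S_{P_i}(\omega)$, assumed convex and compact, and $\mathcal R_{P_i}(\omega)=\phi^{-1}(\mathcal S_{P_i}(\omega))$. Then $$\mathrm{d}_q(P_1,P_2) := \sup_{\omega\in\Omega}\ \inf_{\pi_\omega\in\Pi(\mathbb{P}_{R_1(\omega)},\mathbb{P}_{R_2(\omega)})}\int_{\mathcal{R}_{P_1}(\omega)\times\mathcal{R}_{P_2}(\omega)}\mathrm{d_{chord}}(r_1,r_2)^q\,\pi_\omega(dr_1,dr_2).$$ Here and below $\Pi(\mu,\nu)$ is the set of all joint distributions with marginals $\mu$ and $\nu$. Gap metric: let $\mathcal{H}_2$ be the space of Fourier transforms of $\mathcal{L}_2$ (finite-energy) signals supported on positive time. For a plant with real rational transfer function $P$, take a normalized right coprime factorisation $P=ND^{-1}$, where $N,D$ are proper, stable and real rational, there are proper stable rational $X,Y$ with $XN+YD=I$, and $N^\star N+D^\star D=I$ (on the imaginary axis). The graph of $P$ is the closed subspace $\mathcal{G}_P=\{(u,y)\in\mathcal{H}_2\times\mathcal{H}_2: y=Pu\}=\begin{bmatrix}D\\N\end{bmatrix}\mathcal{H}_2$, and $\Pi_{\mathcal{G}_P}$ is the orthogonal projection onto it. The gap metric is $\delta_g(P_1,P_2)=\|\Pi_{\mathcal{G}_{P_1}}-\Pi_{\mathcal{G}_{P_2}}\|$ (operator norm), and for state-space models $\delta_g(\Sigma_1,\Sigma_2)$ means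 $\delta_g(\mathbf{TF}(\Sigma_1),\mathbf{TF}(\Sigma_2))$. Time-domain distance: $$\mathrm{dist}^{q}_{\Sigma_1,\Sigma_2,\delta_g}:=\inf_{\pi_{\mathbf f}\in\Pi(\mathbf f_1,\mathbf f_2)}\int_{\mathrm{supp}(\mathbf f_1)\times\mathrm{supp}(\mathbf f_2)}\delta_g(\Sigma_1,\Sigma_2)^q\,\pi_{\mathbf f}(d\Sigma_1,d\Sigma_2).$$ No $q$-th roots are taken in either distance. Equivalently, the time-domain distance is the same infimum over joint distributions of the induced transfer-function distributions $\mathbf f_{P_i}=\mathbf{TF}_\#\mathbf f_i$. *)

(* Defs.v *)
From HB Require Import structures.
From mathcomp Require Import all_boot all_order all_algebra fraction.
From mathcomp Require Import complex ring lra.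
From mathcomp Require Import all_classical all_reals all_analysis ess_sup_inf.

Set Implicit Arguments.
Unset Strict Implicit.
Unset Printing Implicit Defensive.

Import Order.TTheory GRing.Theory Num.Theory.
Import numFieldNormedType.Exports.
Import ComplexField.Normc.

Local Open Scope classical_set_scope.
Local Open Scope ring_scope.
Local Open Scope complex_scope.

(* Measurable spaces are pointed in MathComp-Analysis, whereas the type of the
   elements of a set (with its subspace topology) is not. A base point is
   therefore attached; it plays no role in the topology or the sigma-algebra. *)
Definition pointed_at (T : Type) (a : T) : Type := T.

Section pointed_at.
Variables (T : topologicalType) (a : T).
HB.instance Definition _ := Topological.copy (pointed_at a) T.
HB.instance Definition _ := isPointed.Build (pointed_at a) a.
End pointed_at.

Definition borel (T : ptopologicalType) := g_sigma_algebraType (@open T).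

Definition borel_sub (T : topologicalType) (A : set T) (a : A) :=
  borel (@pointed_at A a).

Section distributions.
Context {R : realType}.

Definition couplings d1 d2 (T1 : measurableType d1) (T2 : measurableType d2)
    (mu : set T1 -> \bar R) (nu : set T2 -> \bar R) :
    set (probability (T1 * T2)%type R) :=
  [set pi : probability (T1 * T2)%type R |
    (forall A, measurable A -> pi (A `*` setT) = mu A) /\
    (forall B, measurable B -> pi (setT `*` B) = nu B)].

Definition supp (T : topologicalType) (mu : set T -> \bar R) : set T :=
  [set x | forall U : set T, open U -> U x -> (0 < mu U)%E].

End distributions.

(* R[i] declared as a numeric field, so that the topology induced by the
   modulus can be inferred. *)
Definition Cplx (R : realType) : numClosedFieldType := R[i].

Section transfer_functions.
Context {R : realType}.

Definition ratfun : fieldType := {fraction {poly R}}.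

Definition tf_const (c : R) : ratfun := tofrac c%:P.

Definition tf_s : ratfun := tofrac 'X.

Definition model (n : nat) : Type :=
  ('M[R]_n * 'M[R]_(n, 1) * 'M[R]_(1, n))%type.

HB.instance Definition _ n := Topological.on (model n).

(* C (sI - A)^-1 B, computed in the field of rational functions, where
   sI - A is always invertible. *)
Definition TF n (Sigma : model n) : ratfun :=
  let: (A, B, C) := Sigma in
  (map_mx tf_const C *m invmx (tf_s%:M - map_mx tf_const A)
     *m map_mx tf_const B) 0 0.

(* Value at s of the fraction in lowest terms, hence insensitive to common
   factors of numerator and denominator; at a genuine pole it is 0, by the
   convention on division. *)
Definition tf_eval (P : ratfun) (s : R[i]) : R[i] :=
  let num := (frac (repr P)).1 in
  let den := (frac (repr P)).2 in
  let g := gcdp num den in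
  (map_poly (real_complex R) (num %/ g)).[s]
    / (map_poly (real_complex R) (den %/ g)).[s].

Definition freqresp (P : ratfun) (w : R) : Cplx R := tf_eval P (0 +i* w).

Definition RLinfty : set ratfun :=
  [set P | (ess_sup lebesgue_measure
    (fun w : R => (normc (freqresp P w))%:E) < +oo)%E].

End transfer_functions.

Arguments ratfun : clear implicits.
Arguments model : clear implicits.

Section riemann_sphere.
Context {R : realType}.

Definition sphere : set 'rV[R]_3 :=
  [set r | r 0 0 ^+ 2 + r 0 1 ^+ 2 + (r 0 2%:R - 2^-1) ^+ 2 = 4^-1].

Definition stereo_inv_def (c : R[i]) : 'rV[R]_3 :=
  \row_(i < 3) [:: complex.Re c / (1 + normc c ^+ 2);
                   complex.Im c / (1 + normc c ^+ 2);
                   normc c ^+ 2 / (1 + normc c ^+ 2)]`_i.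

Lemma stereo_inv_subproof c : stereo_inv_def c \in sphere.
Proof.
case: c => a b; rewrite inE /sphere /= !mxE /=.
have ab0 : 0 <= a ^+ 2 + b ^+ 2 by rewrite addr_ge0// sqr_ge0.
have N0 : 1 + (a ^+ 2 + b ^+ 2) != 0 by rewrite gt_eqF// ltr_wpDr.
by rewrite sqr_sqrtr//; field.
Qed.

Definition stereo_inv (c : R[i]) : sphere :=
  exist (fun r => r \in sphere) (stereo_inv_def c) (stereo_inv_subproof c).

HB.instance Definition _ := isPointed.Build sphere (stereo_inv 0).

Definition d_chord (r1 r2 : sphere) : R :=
  Num.sqrt (\sum_(i < 3) (set_val r1 0 i - set_val r2 0 i) ^+ 2).

Definition Psi n (w : R) (Sigma : model R n) : sphere :=
  stereo_inv (freqresp (TF Sigma) w).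

End riemann_sphere.

(* Frequency-domain signals are represented by functions of w on R, the
   imaginary axis being s = jw; functions equal almost everywhere represent
   the same signal. The constant 1 / (2 pi) is dropped from the inner product
   on L2(jR), which does not affect orthogonality or operator norms. *)
Section gap.
Context {R : realType}.
Notation C := R[i].
Notation lambda := (@lebesgue_measure R).

Definition square_integrable (f : R -> C) : Prop :=
  [/\ measurable_fun setT (fun x => complex.Re (f x)),
      measurable_fun setT (fun x => complex.Im (f x)) &
      (\int[lambda]_x ((normc (f x)) ^+ 2)%:E < +oo)%E].

Definition Cintegral (D : set R) (f : R -> C) : C :=
  (\int[lambda]_(x in D) complex.Re (f x))
    +i* (\int[lambda]_(x in D) complex.Im (f x)).

(* [u t * exp (- j w t)] integrated over [- T, T] *)
Definition fourier_trunc (u : R -> C) (T w : R) : C :=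
  Cintegral `[- T, T] (fun t => u t * (cos (w * t) -i* sin (w * t))).

(* Fourier-Plancherel transform: [f] is the L2 limit of the transforms of the
   truncations of [u]. *)
Definition is_fourier (u f : R -> C) : Prop :=
  (\int[lambda]_w ((normc (f w - fourier_trunc u T w)) ^+ 2)%:E)%E
    @[T --> +oo] --> (0 : \bar R).

Definition H2 : set (R -> C) :=
  [set f | square_integrable f /\
    exists u, [/\ square_integrable u, forall t, t < 0 -> u t = 0 &
                  is_fourier u f]].

Definition sigpair : Type := ((R -> C) * (R -> C))%type.

HB.instance Definition _ := GRing.Zmodule.on sigpair.

Definition H2xH2 : set sigpair := H2 `*` H2.

Definition inner (x y : sigpair) : C :=
  Cintegral setT (fun w => x.1 w * (y.1 w)^* + x.2 w * (y.2 w)^*).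

Definition norm2 (x : sigpair) : R :=
  Num.sqrt (\int[lambda]_w (normc (x.1 w) ^+ 2 + normc (x.2 w) ^+ 2)).

Definition graph (P : ratfun R) : set sigpair :=
  [set x | H2xH2 x /\
    {ae lambda, forall w, x.2 w = freqresp P w * x.1 w}].

Definition is_proj (G : set sigpair) (x p : sigpair) : Prop :=
  G p /\ forall g, G g -> inner (x - p) g = 0.

(* Unique up to equality almost everywhere. It exists when [G] is a closed
   subspace, as [graph P] is; 0 is a dummy default. *)
Definition proj (G : set sigpair) (x : sigpair) : sigpair :=
  xget (0 : sigpair) (is_proj G x).

Definition gap (P1 P2 : ratfun R) : \bar R :=
  ereal_sup [set (norm2 (proj (graph P1) x - proj (graph P2) x))%:E
            | x in [set x | H2xH2 x /\ norm2 x <= 1]].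

End gap.

Section distances.
Context {R : realType}.
Local Open Scope ereal_scope.

Section frequency_domain.
Context d (T : measurableType d) (f : probability T R) (P : T -> ratfun R).

Definition freq_law (w : R) : set (borel (Cplx R)) -> \bar R :=
  pushforward f (fun t => freqresp (P t) w : borel (Cplx R)).

Definition freq_supp (w : R) : set (Cplx R) := supp (freq_law w).

Definition sphere_law (w : R) : set (borel (@sphere R)) -> \bar R :=
  pushforward f (fun t => stereo_inv (freqresp (P t) w) : borel (@sphere R)).

Definition sphere_supp (w : R) : set (@sphere R) :=
  [set stereo_inv c | c in freq_supp w].

End frequency_domain.

Definition d_q (q : R)
    d1 (T1 : measurableType d1) (f1 : probability T1 R) (P1 : T1 -> ratfun R)
    d2 (T2 : measurableType d2) (f2 : probability T2 R) (P2 : T2 -> ratfun R) :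
    \bar R :=
  ereal_sup [set
    ereal_inf [set
      \int[pi]_(r in sphere_supp f1 P1 w `*` sphere_supp f2 P2 w)
        ((d_chord r.1 r.2) `^ q)%:E
      | pi in couplings (sphere_law f1 P1 w) (sphere_law f2 P2 w)]
    | w in [set w : R | (0 <= w)%R]].

Definition random_tf (T : Type) n (M : set (model R n)) (Phi : T -> M) (t : T) :
    ratfun R :=
  TF (set_val (Phi t)).

Definition dist_gap n (M : set (model R n)) (m0 : M) (q : R)
    (f1 f2 : set (borel_sub m0) -> \bar R) : \bar R :=
  ereal_inf [set
    \int[pi]_(S in (supp f1 : set M) `*` (supp f2 : set M))
      (gap (TF (set_val S.1)) (TF (set_val S.2))) `^ q
    | pi in couplings f1 f2].

End distances.

(* Main.v *)
Require Import Defs.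
From HB Require Import structures.
From mathcomp Require Import all_boot all_order all_algebra.
From mathcomp Require Import complex ring lra.
From mathcomp Require Import all_classical all_reals all_analysis.
From mathcomp Require Import measurable_realfun ess_sup_inf.

Set Implicit Arguments.
Unset Strict Implicit.
Unset Printing Implicit Defensive.

Import Order.TTheory GRing.Theory Num.Theory.
Import numFieldNormedType.Exports.

Local Open Scope classical_set_scope.
Local Open Scope ring_scope.

(* Pushing a coupling of the laws of the models forward along the pair of maps
   [Psi w] yields a coupling of the laws on the sphere, and the supports have
   full measure since the space of models is second countable. It is therefore
   enough to bound, at every frequency [w0], the chordal distance by the gap.

   Let [P1 = n1 / d1], [P2 = n2 / d2] in lowest terms; neither has a pole on the
   imaginary axis. Then [x = (d1, n1) / (s - j w0 + 2)^N] belongs to the graph of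
   [P1] as soon as [N] exceeds the degrees, and no coprime factorisation over the
   stable functions is needed. Pointwise in [w], every element of the graph of
   [P2] lies at squared distance at least [kappa(w)^2 |x(w)|^2] from [x], [kappa(w)] being the chordal
   distance between [P1(jw)] and [P2(jw)], so that
   [int kappa^2 |x|^2 <= gap^2 int |x|^2]. As [N] grows, [|x|^2] concentrates at
   [w0], whence [kappa(w0) <= gap]. *)

(** * Supports and push-forwards *)

(** The integral of a nonnegative function is the supremum of the integrals of the simple functions
    below it, so a larger function on a larger set admits more competitors. This form applies to
    integrands such as the gap, whose measurability is not established. *)
Lemma ge0_le_integral_subset d (T : measurableType d) (R : realType)
    (mu : {measure set T -> \bar R}) (A B : set T) (f g : T -> \bar R) :
  A `<=` B -> (forall x, A x -> (0 <= f x)%E) ->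
  (forall x, A x -> (f x <= g x)%E) -> (forall x, B x -> (0 <= g x)%E) ->
  (\int[mu]_(x in A) f x <= \int[mu]_(x in B) g x)%E.
Proof.
move=> AB f0 fg g0; rewrite !ge0_integralE//.
apply: ereal_sup_le => _ /= [h hf <-]; exists h => // x.
apply: le_trans (hf x) _; rewrite !patchE.
case: ifPn => [/set_mem Ax|_].
  by rewrite ifT; [exact: fg|rewrite inE; exact: AB].
by case: ifPn => // /set_mem /g0.
Qed.

(** The base consists of interiors of balls with centre in [D] and rational radius; interiors are
    taken because a ball of a pseudometric space need not be open. *)
Lemma dense_second_countable (R : realType) (T : pseudoMetricType R)
    (D : set T) :
  countable D -> (forall x (e : R), 0 < e -> exists2 y, D y & ball x e y) ->
  @second_countable T.
Proof.
move=> cD dD.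
exists [set (ball yr.1 (ratr yr.2))° | yr in D `*` [set: rat]].
  by apply: sub_countable (card_image_le _ _) _; exact: countableX.
split.
  by move=> _ [[y r] _ <-]; exact: open_interior.
move=> x U; rewrite -nbhs_ballE => -[e /= e0 eU].
have [r] := @rat_in_itvoo R 0 (e / 2) ltac:(by rewrite divr_gt0).
rewrite in_itv/= => /andP[r0 re].
(* Half the radius puts [x] in the interior of the ball around [y], while [r < e / 2] keeps that
   ball inside the ball of radius [e] around [x]. *)
have [y Dy xy] := dD x (ratr r / 2) ltac:(by rewrite divr_gt0).
exists (ball y (ratr r))°; last first.
  move=> z /interior_subset yz; apply: eU.
  apply: (@le_ball _ _ _ (ratr r / 2 + ratr r)); last exact: ball_triangle xy yz.
  by move: r0 re; set a : R := ratr r; lra.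
split; first by exists (y, r).
rewrite /interior -nbhs_ballE; exists (ratr r / 2) => /=.
  by rewrite divr_gt0.
move=> z xz; apply: (@le_ball _ _ _ (ratr r / 2 + ratr r / 2)); first by lra.
by apply: ball_triangle xz; exact: ball_sym.
Qed.

Lemma second_countable_model (R : realType) n :
  @second_countable (model R n).
Proof.
pose r m k : 'M[rat]_(m, k) -> 'M[R]_(m, k) := map_mx ratr.
pose h (x : 'M[rat]_n * 'M[rat]_(n, 1) * 'M[rat]_(1, n)) : model R n :=
  (r _ _ x.1.1, r _ _ x.1.2, r _ _ x.2).
apply: (@dense_second_countable R
  ('M[R]_n * 'M[R]_(n, 1) * 'M[R]_(1, n))%type (range h)).
  exact: sub_countable (card_image_le _ _) (countableP _).
have rP m k (A : 'M[R]_(m, k)) (e : R) : 0 < e ->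
    exists B : 'M[rat]_(m, k), ball A e (r _ _ B).
  move=> e0.
  have /choice[B BP] : forall ij, exists b : rat,
      ball (A ij.1 ij.2) e (ratr b : R).
    move=> ij; have [b] := @rat_in_itvoo R (A ij.1 ij.2) (A ij.1 ij.2 + e)
      ltac:(by rewrite ltrDl).
    rewrite in_itv/= => /andP[b1 b2]; exists b.
    by rewrite /ball/= distrC ger0_norm ?subr_ge0 ?ltW// ltrBlDl.
  exists (\matrix_(i, j) B (i, j)); split=> // i j.
  by rewrite !mxE; exact: (BP (i, j)).
move=> [[A B] C] e e0.
have [A' ?] := rP _ _ A _ e0; have [B' ?] := rP _ _ B _ e0.
have [C' ?] := rP _ _ C _ e0.
by exists (h (A', B', C')) => //; exists (A', B', C').
Qed.

Lemma second_countable_set_type (T : topologicalType) (M : set T) :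
  @second_countable T -> @second_countable M.
Proof.
move=> [B cB [oB nB]].
exists [set set_val @^-1` U | U in B]; first exact: sub_countable (card_image_le _ _) cB.
split; first by move=> _ [U BU <-]; exists U => //; exact: oB.
move=> x U [_ [[V oV <-] Vx VU]].
have [W [BW Wx] WV] := nB (set_val x) V (open_nbhs_nbhs (conj oV Vx)).
by exists (set_val @^-1` W) => [|y Wy]; [split => //; exists W|exact/VU/WV].
Qed.

Lemma open_supp_compl (R : realType) (T : topologicalType)
    (mu : set T -> \bar R) : (forall U, (0 <= mu U)%E) ->
  open (~` supp mu).
Proof.
move=> mu0; rewrite openE => x.
move=> /existsNP[U] /not_implyP[oU] /not_implyP[Ux] /negP; rewrite -leNgt => mU.
rewrite /interior nbhsE; exists U => // y Uy /(_ U oU Uy).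
by rewrite ltNge mU.
Qed.

(** Each point outside the support has a null neighbourhood, hence a null neighbourhood from the
    countable base; the complement is thus covered by countably many null sets. *)
Lemma measure_supp_compl (R : realType) (T : ptopologicalType)
    (mu : {measure set (borel T) -> \bar R}) : @second_countable T ->
  mu (~` supp mu) = 0.
Proof.
move=> [B cB [oB nB]].
have oS : open (~` supp mu) by apply: open_supp_compl => U; exact: measure_ge0.
have moB (U : set T) : open U -> measurable (U : set (borel T)).
  by move=> oU; apply: sub_sigma_algebra.
apply/negligibleP; first exact: moB.
pose B0 := [set U | B U /\ mu U = 0].
have cB0 : countable B0 by apply: sub_countable cB; apply: subset_card_le => U [].
apply: (@negligibleS _ (borel T) _ mu (\bigcup_(U in B0) U)).
  move=> x /existsNP[U] /not_implyP[oU] /not_implyP[Ux] /negP.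
  rewrite -leNgt => mU.
  have [W [BW Wx] WU] := nB x U (open_nbhs_nbhs (conj oU Ux)).
  exists W => //; split=> //; apply/eqP; rewrite eq_le measure_ge0 andbT.
  by apply: le_trans mU; apply: le_measure => //; rewrite inE; [exact (moB W (oB W BW))|exact: moB].
have /countable_injP[f f_inj] := cB0.
(* The union is reindexed by the natural numbers: as [f] is injective on [B0], each inner union has
   at most one member. *)
apply: (@negligibleS _ (borel T) _ mu (\bigcup_k \bigcup_(U in B0 `&` f @^-1` [set k]) U)).
  by move=> x [U B0U Ux]; exists (f U) => //; exists U.
apply: negligible_bigcup => k.
have [->|/set0P[U [B0U fU]]] := eqVneq (B0 `&` f @^-1` [set k]) set0.
  by rewrite bigcup_set0; exact: negligible_set0.
rewrite (_ : \bigcup_(_ in _) _ = U).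
  by apply/negligibleP; [exact: (moB U (oB U B0U.1))|exact: B0U.2].
apply/seteqP; split=> [x [V [B0V fV] Vx]|x Ux]; last by exists U.
by rewrite (f_inj U V) ?inE//= fU.
Qed.

Lemma continuous_borel_measurable (S T : ptopologicalType) (f : S -> T) :
  continuous f -> measurable_fun setT (f : borel S -> borel T).
Proof.
move=> cf; apply: (@measurability _ _ (borel S) (borel T) setT f (@open T)) => //.
move=> _ [U oU <-]; rewrite setTI; apply: sub_sigma_algebra.
by apply: open_comp => // x _; exact: cf.
Qed.

(** Separate from the preceding lemma because the target carries the sigma-algebra attached to [R]
    rather than that of [borel R]; open intervals generate the former. *)
Lemma continuous_borel_measurable_real (R : realType) (S : ptopologicalType)
    (f : S -> R) :
  continuous f -> measurable_fun setT (f : borel S -> R).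
Proof.
move=> cf; apply: (measurability _ (RGenOpens.measurableE R)).
move=> _ [_ [a [b ->] <-]]; rewrite setTI; apply: sub_sigma_algebra.
apply: open_comp => [x _|]; first exact: cf.
exact: interval_open.
Qed.

Lemma measurable_d_chord (R : realType) :
  measurable_fun setT
    (fun r : borel (@sphere R) * borel (@sphere R) => d_chord r.1 r.2).
Proof.
have mcoord i : measurable_fun setT
    (fun r : borel (@sphere R) => (set_val r 0 i : R)).
  apply: (@continuous_borel_measurable_real R (@sphere R)
    (fun r : @sphere R => (set_val r 0 i : R))) => r.
  apply: (@continuous_comp _ _ _ set_val (fun r : 'rV[R]_3 => r 0 i)).
    exact: initial_continuous.
  exact: coord_continuous.
have msqrt : measurable_fun setT (@Num.sqrt R).
  exact: (continuous_measurable_fun (@sqrt_continuous R)).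
apply: (measurableT_comp msqrt).
apply: measurable_sum => i; apply: measurable_funX; apply: measurable_funB.
  exact: (measurableT_comp (mcoord i) measurable_fst).
exact: (measurableT_comp (mcoord i) measurable_snd).
Qed.

Lemma measurable_prod_map d1 d2 d1' d2' (T1 : measurableType d1)
    (T2 : measurableType d2) (T1' : measurableType d1')
    (T2' : measurableType d2') (f1 : T1 -> T1') (f2 : T2 -> T2') :
  measurable_fun setT f1 -> measurable_fun setT f2 ->
  measurable_fun setT (fun x : T1 * T2 => (f1 x.1, f2 x.2)).
Proof.
move=> mf1 mf2; apply: measurable_fun_pair.
  exact: (measurableT_comp mf1 measurable_fst).
exact: (measurableT_comp mf2 measurable_snd).
Qed.

(** * Calculus of complex-valued functions of a real variable *)

Section complex_valued.
Local Open Scope complex_scope.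
Import ComplexField.Normc.
Context {R : realType}.
Local Notation C := R[i].
Implicit Types (f g : R -> C) (c : C).

Lemma normc_sqr c : normc c ^+ 2 = complex.Re c ^+ 2 + complex.Im c ^+ 2.
Proof. by case: c => a b /=; rewrite sqr_sqrtr// addr_ge0// sqr_ge0. Qed.

Lemma normc_nneg c : 0 <= normc c.
Proof. by case: c => a b; exact: sqrtr_ge0. Qed.

Lemma normc_real (a : R) : normc a%:C = `|a|.
Proof. by rewrite /= expr0n addr0 sqrtr_sqr. Qed.

Lemma normcX c n : normc (c ^+ n) = normc c ^+ n.
Proof.
by elim: n => [|n ih]; rewrite ?expr0 ?normc1// !exprS normcM ih.
Qed.

Lemma Re_mul c1 c2 : complex.Re (c1 * c2) =
  complex.Re c1 * complex.Re c2 - complex.Im c1 * complex.Im c2.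
Proof. by case: c1; case: c2. Qed.

Lemma Im_mul c1 c2 : complex.Im (c1 * c2) =
  complex.Re c1 * complex.Im c2 + complex.Im c1 * complex.Re c2.
Proof. by case: c1; case: c2. Qed.

Lemma Re_add c1 c2 : complex.Re (c1 + c2) = complex.Re c1 + complex.Re c2.
Proof. by case: c1; case: c2. Qed.

Lemma Im_add c1 c2 : complex.Im (c1 + c2) = complex.Im c1 + complex.Im c2.
Proof. by case: c1; case: c2. Qed.

Lemma Re_opp c : complex.Re (- c) = - complex.Re c.
Proof. by case: c. Qed.

Lemma Im_opp c : complex.Im (- c) = - complex.Im c.
Proof. by case: c. Qed.

(** Continuity is taken componentwise, so that no topology on [R[i]] has to be chosen and the
    real-valued calculus applies directly. *)
Definition contC f := continuous (fun t => complex.Re (f t)) /\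
  continuous (fun t => complex.Im (f t)).

Lemma contC_cst c : contC (fun=> c).
Proof. by split; exact: cst_continuous. Qed.

Lemma contCD f g : contC f -> contC g -> contC (fun t => f t + g t).
Proof.
move=> [cf1 cf2] [cg1 cg2]; split => t.
- by under eq_fun do rewrite Re_add; apply: cvgD; [exact: cf1|exact: cg1].
- by under eq_fun do rewrite Im_add; apply: cvgD; [exact: cf2|exact: cg2].
Qed.

Lemma contCM f g : contC f -> contC g -> contC (fun t => f t * g t).
Proof.
move=> [cf1 cf2] [cg1 cg2]; split => t.
- under eq_fun do rewrite Re_mul; apply: cvgB; apply: cvgM;
    by [exact: cf1|exact: cg1|exact: cf2|exact: cg2].
- under eq_fun do rewrite Im_mul; apply: cvgD; apply: cvgM;
    by [exact: cf1|exact: cg1|exact: cf2|exact: cg2].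
Qed.

Lemma contC_horner (p : {poly C}) f : contC f -> contC (fun t => p.[f t]).
Proof.
move=> cf; elim/poly_ind: p => [|p c ih].
  by under eq_fun do rewrite horner0; exact: contC_cst.
under eq_fun do rewrite hornerMXaddC.
by apply: contCD; [exact: contCM|exact: contC_cst].
Qed.

Lemma contC_normc f : contC f -> continuous (fun t => normc (f t) ^+ 2).
Proof.
move=> [cf1 cf2] t; under eq_fun do rewrite normc_sqr.
by apply: cvgD; under eq_fun do rewrite expr2; apply: cvgM;
  [exact: cf1|exact: cf1|exact: cf2|exact: cf2].
Qed.

Lemma contCV f : contC f -> (forall w, f w != 0) ->
  contC (fun w => (f w)^-1).
Proof.
move=> cf f0; have [c1 c2] := cf; have cn := contC_normc cf.
have n0 w : normc (f w) ^+ 2 != 0.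
  by rewrite sqrf_eq0; apply: contra (f0 w) => /eqP/eq0_normc ->.
have e w : (f w)^-1 = (complex.Re (f w) / normc (f w) ^+ 2)
    -i* (complex.Im (f w) / normc (f w) ^+ 2).
  rewrite normc_sqr; case: (f w) => a b /=.
  by apply/eqP; rewrite eq_complex/= -mulNr !eqxx.
split => w.
- under eq_fun do rewrite e/=.
  by apply: cvgM; [exact: c1|apply: cvgV => //; exact: cn].
- under eq_fun do rewrite e/=.
  by apply: cvgN; apply: cvgM; [exact: c2|apply: cvgV => //; exact: cn].
Qed.

Lemma contC_real : contC (fun t : R => t%:C).
Proof. by split => t /=; [exact: cvg_id|exact: cst_continuous]. Qed.

Definition is_derivC f g := forall t : R,
  is_derive t 1 (fun t => complex.Re (f t)) (complex.Re (g t)) /\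
  is_derive t 1 (fun t => complex.Im (f t)) (complex.Im (g t)).

Lemma is_derivC_eq f g g' : is_derivC f g -> g =1 g' -> is_derivC f g'.
Proof. by move=> fg gg' t; rewrite -gg'. Qed.

Lemma is_derivC_cst c : is_derivC (fun=> c) (fun=> 0).
Proof. by move=> t; split; exact: is_derive_cst. Qed.

Lemma is_derivCD f g f' g' : is_derivC f f' -> is_derivC g g' ->
  is_derivC (fun t => f t + g t) (fun t => f' t + g' t).
Proof.
move=> df dg t; have [f1 f2] := df t; have [g1 g2] := dg t; split.
- by rewrite Re_add; under eq_fun do rewrite Re_add; exact: is_deriveD.
- by rewrite Im_add; under eq_fun do rewrite Im_add; exact: is_deriveD.
Qed.

Lemma is_derivCM f g f' g' : is_derivC f f' -> is_derivC g g' ->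
  is_derivC (fun t => f t * g t) (fun t => f' t * g t + f t * g' t).
Proof.
move=> df dg t; have [f1 f2] := df t; have [g1 g2] := dg t; split.
- under eq_fun do rewrite Re_mul.
  apply: (is_derive_eq (is_deriveB (is_deriveM f1 g1) (is_deriveM f2 g2))).
  by rewrite Re_add !Re_mul; rewrite /GRing.scale/=; ring.
- under eq_fun do rewrite Im_mul.
  apply: (is_derive_eq (is_deriveD (is_deriveM f1 g2) (is_deriveM f2 g1))).
  by rewrite Im_add !Im_mul; rewrite /GRing.scale/=; ring.
Qed.

Lemma is_derivC_real : is_derivC (fun t => t%:C) (fun=> 1).
Proof. by move=> t; split=> /=; [exact: is_derive_id|exact: is_derive_cst]. Qed.

Lemma is_derivC_horner (p : {poly C}) :
  is_derivC (fun t => p.[t%:C]) (fun t => p^`().[t%:C]).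
Proof.
elim/poly_ind: p => [|p c ih].
  under eq_fun do rewrite horner0.
  by apply: is_derivC_eq (is_derivC_cst _) _ => t; rewrite deriv0 horner0.
under eq_fun do rewrite hornerMXaddC.
apply: is_derivC_eq (is_derivCD (is_derivCM ih is_derivC_real) (is_derivC_cst _)) _ => t.
by rewrite derivD derivM derivX derivC !hornerE; ring.
Qed.

(** The complex exponential [e^(-(2 + iw)t)], written in components. *)
Definition damped (w t : R) : C :=
  (expR (- (2 * t)) * cos (w * t)) -i* (expR (- (2 * t)) * sin (w * t)).

Lemma is_derivC_damped w :
  is_derivC (damped w) (fun t => - (2 +i* w) * damped w t).
Proof.
move=> t; split => /=.
- apply: is_derive_eq; rewrite /GRing.scale/=; ring.
- apply: is_derive_eq; rewrite /GRing.scale/=; ring.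
Qed.

Lemma is_derivC_cont f g : is_derivC f g -> contC f.
Proof.
by move=> fg; split => t; have [df dg] := fg t;
  apply/differentiable_continuous/derivable1_diffP; exact: ex_derive.
Qed.

Lemma Cintegral_is_derivC f g (T : R) : 0 < T -> is_derivC f g -> contC g ->
  Cintegral `[0, T] g = f T - f 0.
Proof.
move=> T0 fg [cg1 cg2]; have [cf1 cf2] := is_derivC_cont fg.
rewrite /Cintegral; apply/eqP; rewrite eq_complex/=; apply/andP; split; apply/eqP.
- rewrite Re_add Re_opp /Rintegral (continuous_FTC2 (F := fun t => complex.Re (f t)))//.
  + exact: continuous_subspaceT.
  + split.
    * by move=> t _; have [? _] := fg t; exact: ex_derive.
    * exact/cvg_at_right_filter/cf1.
    * exact/cvg_at_left_filter/cf1.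
  + by move=> t _; have [? _] := fg t; rewrite derive1E; exact: derive_val.
- rewrite Im_add Im_opp /Rintegral (continuous_FTC2 (F := fun t => complex.Im (f t)))//.
  + exact: continuous_subspaceT.
  + split.
    * by move=> t _; have [_ ?] := fg t; exact: ex_derive.
    * exact/cvg_at_right_filter/cf2.
    * exact/cvg_at_left_filter/cf2.
  + by move=> t _; have [_ ?] := fg t; rewrite derive1E; exact: derive_val.
Qed.

End complex_valued.

(** * Rational elements of the Hardy space *)

Section hardy.
Local Open Scope complex_scope.
Import ComplexField.Normc.
Context {R : realType}.
Local Notation C := R[i].
Local Notation lambda := (@lebesgue_measure R).

Lemma oneDsqrV_ge0 (x : R) : 0 <= (oneDsqr x)^-1.
Proof. by rewrite invr_ge0 (le_trans ler01)// oneDsqr_ge1. Qed.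

Lemma integral_oneDsqrV_lty :
  (\int[lambda]_x ((oneDsqr x)^-1)%:E < +oo)%E.
Proof.
rewrite ge0_symfun_integralT.
- rewrite (_ : [set x : R | 0 <= x] = `[0, +oo[%classic).
    by rewrite integral0y_oneDsqr -EFinM ltry.
  by apply/seteqP; split => x /=; rewrite in_itv/= andbT.
- exact: oneDsqrV_ge0.
- exact: continuous_oneDsqrV.
- by move=> x /=; rewrite /oneDsqr sqrrN.
Qed.

Lemma integral_scaled_oneDsqrV (k : R) : 0 <= k ->
  (\int[lambda]_x (k * (oneDsqr x)^-1)%:E =
   k%:E * \int[lambda]_x ((oneDsqr x)^-1)%:E)%E.
Proof.
move=> k0; under eq_integral do rewrite EFinM.
apply: ge0_integralZl_EFin => //.
apply/measurable_EFinP; apply: continuous_measurable_fun.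
exact: continuous_oneDsqrV.
Qed.

(** By induction on the polynomial, half of the rate [a] pays for the shorter polynomial and the
    other half for the additional factor [t]. *)
Lemma normc_horner_le_expR (p : {poly C}) (a : R) : 0 < a ->
  exists2 K, 0 <= K & forall t, 0 <= t -> normc p.[t%:C] <= K * expR (a * t).
Proof.
move: p a; apply: poly_ind => [|p c ih] a a0.
  by exists 0 => // t _; rewrite horner0 normc0 mul0r.
have [K K0 pK] := ih (a / 2) ltac:(by rewrite divr_gt0).
exists (K * (2 / a) + normc c) => [|t t0].
  by rewrite addr_ge0 ?normc_nneg// mulr_ge0// divr_ge0// ltW.
rewrite hornerMXaddC (le_trans (le_normcD _ _))// mulrDl lerD//; last first.
  by rewrite ler_peMr ?normc_nneg// -expR0 ler_expR mulr_ge0// ltW.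
rewrite normcM normc_real ger0_norm//.
rewrite (_ : a * t = a / 2 * t + a / 2 * t); last by field.
rewrite expRD.
(* This is [1 + x <= e^x] at [x = a t / 2]. *)
have tE : t <= 2 / a * expR (a / 2 * t).
  have := expR_ge1Dx (a / 2 * t).
  rewrite -ler_pdivrMl ?divr_gt0// invf_div; lra.
rewrite (_ : _ * _ = K * expR (a / 2 * t) * (2 / a * expR (a / 2 * t))); last by ring.
by apply: ler_pM => //; [exact: normc_nneg|exact: pK].
Qed.

Lemma normc_sum (I : Type) (r : seq I) (F : I -> C) :
  normc (\sum_(i <- r) F i) <= \sum_(i <- r) normc (F i).
Proof.
elim/big_ind2 : _ => [|x1 x2 y1 y2 h1 h2|//]; first by rewrite normc0.
by rewrite (le_trans (le_normcD _ _))// lerD.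
Qed.

(** The value of [s - j w0 + 2] at [s = jw]; its only zero, [-2 + j w0], lies in the open left
    half-plane. *)
Definition zpole (w0 w : R) : C := 2 +i* (w - w0).

Lemma zpole_neq0 w0 w : zpole w0 w != 0.
Proof. by rewrite /zpole eq_complex/= pnatr_eq0. Qed.

Lemma normc_zpole w0 w : normc (zpole w0 w) ^+ 2 = 4 + (w - w0) ^+ 2.
Proof. by rewrite normc_sqr /=; ring. Qed.

Lemma normc_zpole_gt0 w0 w : 0 < normc (zpole w0 w).
Proof.
by rewrite lt_def normc_nneg andbT; apply: contra (zpole_neq0 w0 w) => /eqP/eq0_normc ->.
Qed.

Lemma normc_zpole_ge1 w0 w : 1 <= normc (zpole w0 w).
Proof.
rewrite -(@ler_pXn2r _ 2)// ?nnegrE ?normc_nneg// normc_zpole expr1n.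
by have := sqr_ge0 (w - w0); lra.
Qed.

(** Comparison with an integrable function, resting on [w^2 <= 2 (w - w0)^2 + 2 w0^2]. *)
Lemma normc_zpoleV_le w0 w :
  (normc (zpole w0 w) ^+ 2)^-1 <= (2 + 2 * w0 ^+ 2) * (oneDsqr w)^-1.
Proof.
have h1 : 0 < oneDsqr w by exact: lt_le_trans (oneDsqr_ge1 w).
rewrite ler_pdivlMr// mulrC ler_pdivrMr ?exprn_gt0 ?normc_zpole_gt0//.
rewrite normc_zpole /oneDsqr.
have := sqr_ge0 (w - 2 * w0); have := sqr_ge0 w0; have := sqr_ge0 (w - w0).
have := sqr_ge0 (w0 * (w - w0)).
rewrite exprMn => *; nra.
Qed.

Lemma contC_zpole w0 : contC (zpole w0).
Proof.
split => w; first exact: cst_continuous.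
by apply: cvgB; [exact: cvg_id|exact: cst_continuous].
Qed.

Lemma contC_zpoleV w0 : contC (fun w => (zpole w0 w)^-1).
Proof. by apply: contCV; [exact: contC_zpole|exact: zpole_neq0]. Qed.

End hardy.

(** * Laplace transforms of polynomials times exponentials *)

Section hardy_rational.
Local Open Scope complex_scope.
Import ComplexField.Normc.
Context {R : realType}.
Local Notation C := R[i].
Local Notation lambda := (@lebesgue_measure R).
Implicit Types (p Q : {poly C}) (w t T : R) (z : C) (N : nat).

(* [- e^(-zt) lap p N z] is a primitive of [p e^(-zt)]; in particular the Laplace
   transform of [p] at [z] is the value of [lap p N z] at 0. *)
Definition lap p N z : {poly C} := \sum_(i < N) z^-1 ^+ i.+1 *: p^`(i).

Lemma lapE p N z : (size p <= N)%N -> z != 0 ->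
  z *: lap p N z = p + (lap p N z)^`().
Proof.
move=> pN z0; rewrite /lap scaler_sumr raddf_sum/=.
under eq_bigr do rewrite scalerA exprS mulrA mulfV// mul1r.
under [in RHS]eq_bigr do rewrite derivZ -derivnS.
case: N pN => [|N] pN.
  by move: pN; rewrite leqn0 size_poly_eq0 => /eqP ->; rewrite !big_ord0 addr0.
rewrite big_ord_recl/= expr0 scale1r; congr (_ + _).
rewrite [RHS]big_ord_recr/= -[(p^`(N))^`()]derivnS (derivn_poly0 pN) scaler0 addr0.
by apply: eq_bigr => i _; rewrite /bump add1n.
Qed.

Definition causal_signal p w0 t : C :=
  if t < 0 then 0 else p.[t%:C] * damped (- w0) t.

Lemma damped_shift w0 w t :
  damped (- w0) t * (cos (w * t) -i* sin (w * t)) = damped (w - w0) t.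
Proof.
rewrite /damped mulrBl !mulNr cosN sinN cosB sinB.
by apply/eqP; rewrite eq_complex/=; apply/andP; split; apply/eqP; ring.
Qed.

Lemma normc_damped w t : normc (damped w t) = expR (- (2 * t)).
Proof.
apply/eqP; rewrite -(@eqrXn2 _ 2)// ?normc_nneg ?expR_ge0// normc_sqr/= sqrrN.
by rewrite !exprMn -mulrDr cos2Dsin2 mulr1.
Qed.

Lemma contC_damped w : contC (damped w).
Proof. exact: is_derivC_cont (is_derivC_damped w). Qed.

Lemma measurable_contC (f : R -> C) : contC f ->
  measurable_fun setT (fun x => complex.Re (f x)) /\
  measurable_fun setT (fun x => complex.Im (f x)).
Proof. by move=> [c1 c2]; split; exact: continuous_measurable_fun. Qed.

Lemma square_integrable_causal p w0 : square_integrable (causal_signal p w0).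
Proof.
have cp : contC (fun t => p.[t%:C] * damped (- w0) t).
  by apply: contCM; [exact: (contC_horner p contC_real)|exact: contC_damped].
have [m1 m2] := measurable_contC cp.
have mlt : measurable_fun setT (fun t : R => t < 0).
  exact: measurable_fun_ltr.
split.
- under eq_fun do rewrite /causal_signal (fun_if (@complex.Re R)).
  exact: measurable_fun_ifT.
- under eq_fun do rewrite /causal_signal (fun_if (@complex.Im R)).
  exact: measurable_fun_ifT.
(* At rate 1 the squared modulus is at most [K^2 e^(2t) e^(-4t) = K^2 e^(-2t)], that is [K^2 / 2]
   times the density of the exponential law of rate 2, which has integral 1. *)
have [K K0 pK] := normc_horner_le_expR p (@ltr01 R).
apply: (@le_lt_trans _ _
  (\int[lambda]_x (K ^+ 2 / 2 * exponential_pdf 2 x)%:E)%E).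
  apply: ge0_le_integral_subset => // [t _|t _|t _].
  - by rewrite lee_fin sqr_ge0.
  - rewrite lee_fin /causal_signal; case: ltP => t0.
      by rewrite normc0 expr0n/= lt0_exponential_pdf// mulr0.
    rewrite exponential_pdfE// normcM exprMn normc_damped.
    apply: (@le_trans _ _ ((K * expR (1 * t)) ^+ 2 * expR (- (2 * t)) ^+ 2)).
      rewrite ler_pM2r ?exprn_gt0 ?expR_gt0// ler_pXn2r ?nnegrE ?normc_nneg//.
        exact: pK.
      by rewrite mulr_ge0// expR_ge0.
    have e2 : expR (1 * t) ^+ 2 * expR (- (2 * t)) ^+ 2 <= expR (- 2 * t).
      by rewrite -!expRM_natl -expRD ler_expR; lra.
    apply: (@le_trans _ _ (K ^+ 2 * expR (- 2 * t))).
      rewrite (_ : _ * _ = K ^+ 2 * (expR (1 * t) ^+ 2 * expR (- (2 * t)) ^+ 2)); last by ring.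
      exact: ler_wpM2l (sqr_ge0 K) _ _ e2.
    by rewrite le_eqVlt; apply/orP; left; apply/eqP => /=; field.
  - rewrite lee_fin mulr_ge0 ?divr_ge0 ?sqr_ge0//.
    by apply: exponential_pdf_ge0.
under eq_integral do rewrite EFinM.
rewrite ge0_integralZl_EFin//.
- by rewrite integral_exponential_pdf// mule1 ltry.
- by move=> x _; rewrite lee_fin exponential_pdf_ge0.
- by apply/measurable_EFinP; exact: measurable_exponential_pdf.
- by rewrite divr_ge0 ?sqr_ge0.
Qed.

(** The primitive provided by [lapE] is evaluated between 0 and [T]; its term at [T] is the
    truncation error. *)
Lemma fourier_trunc_causal p N w0 w T : (size p <= N)%N -> 0 < T ->
  fourier_trunc (causal_signal p w0) T w =
  (lap p N (zpole w0 w)).[0]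
    - damped (w - w0) T * (lap p N (zpole w0 w)).[T%:C].
Proof.
move=> pN T0; set z := zpole w0 w; set S := lap p N z.
have dF : is_derivC (fun t => - 1 * (damped (w - w0) t * S.[t%:C]))
                    (fun t => p.[t%:C] * damped (w - w0) t).
  apply: is_derivC_eq.
    apply: is_derivCM; first exact: is_derivC_cst.
    by apply: is_derivCM; [exact: is_derivC_damped|exact: is_derivC_horner].
  move=> t /=; rewrite mul0r add0r -/(zpole w0 w) -/z.
  have := congr1 (fun q : {poly C} => q.[t%:C]) (lapE pN (zpole_neq0 w0 w)).
  rewrite -/z -/S hornerZ hornerD => zS.
  rewrite [X in - 1 * X](_ : _ =
    damped (w - w0) t * (S^`().[t%:C] - z * S.[t%:C])); last by ring.
  by rewrite zS; ring.
have cF : contC (fun t => p.[t%:C] * damped (w - w0) t).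
  by apply: contCM; [exact: (contC_horner p contC_real)|exact: contC_damped].
have := Cintegral_is_derivC T0 dF cF.
have -> : Cintegral `[0, T] (fun t => p.[t%:C] * damped (w - w0) t) =
    fourier_trunc (causal_signal p w0) T w.
  have e t : causal_signal p w0 t * (cos (w * t) -i* sin (w * t)) =
      if t < 0 then 0 else p.[t%:C] * damped (w - w0) t.
    by rewrite /causal_signal; case: ifP => _; rewrite ?mul0r// -mulrA damped_shift.
  (* Used with [h] the real and the imaginary part: the signal vanishes at negative times, so
     [[- T, T]] may replace [[0, T]]. *)
  have r (h : C -> R) : h 0 = 0 ->
      \int[lambda]_(t in `[0, T]) h (p.[t%:C] * damped (w - w0) t) =
      \int[lambda]_(t in `[- T, T])
        h (causal_signal p w0 t * (cos (w * t) -i* sin (w * t))).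
    move=> h0; rewrite Rintegral_mkcond [RHS]Rintegral_mkcond.
    apply: eq_Rintegral => t _; rewrite !patchE e !mem_setE !in_itv/=.
    case: ltP => t0 /=; first by rewrite h0 if_same.
    by rewrite (le_trans _ t0)// oppr_le0 ltW.
  by rewrite /fourier_trunc /Cintegral !r.
move=> ->; have -> : damped (w - w0) 0 = 1.
  apply/eqP; rewrite /damped !mulr0 oppr0 expR0 cos0 sin0 eq_complex/=.
  by rewrite mulr1 mulr0 oppr0 !eqxx.
ring.
Qed.

(** Since [|z| >= 1], every power of [1 / z] in the sum is bounded by [1 / |z|]. This factor gives
    square integrability in [w], with [K] independent of [w]. *)
Lemma normc_lap_le p N w0 : exists2 K, 0 <= K &
  forall w t, 0 <= t ->
    normc (lap p N (zpole w0 w)).[t%:C] <= K * expR t * (normc (zpole w0 w))^-1.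
Proof.
have /choice[K KP] : forall i : 'I_N, exists K, 0 <= K /\
    forall t, 0 <= t -> normc (p^`(i)).[t%:C] <= K * expR t.
  move=> i; have [K K0 KP] := normc_horner_le_expR p^`(i) (@ltr01 R).
  by exists K; split=> // t t0; rewrite -[t in expR t]mul1r; exact: KP.
exists (\sum_i K i) => [|w t t0]; first by apply: sumr_ge0 => i _; case: (KP i).
have z1 := normc_zpole_ge1 w0 w; have z0 := normc_zpole_gt0 w0 w.
rewrite /lap horner_sum (le_trans (normc_sum _ _))// !mulr_suml.
apply: ler_sum => i _; rewrite hornerZ normcM mulrC.
have [_ Ki] := KP i.
apply: ler_pM; rewrite ?normc_nneg ?Ki//.
rewrite normcX normcV exprS ler_piMr ?invr_ge0 ?(ltW z0)//.
by rewrite exprn_ile1 ?invr_ge0 ?(ltW z0)// invf_le1.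
Qed.

Lemma is_fourier_causal p N w0 : (size p <= N)%N ->
  is_fourier (causal_signal p w0) (fun w => (lap p N (zpole w0 w)).[0]).
Proof.
move=> pN; have [K K0 KP] := normc_lap_le p N w0.
set L := (\int[lambda]_x ((oneDsqr x)^-1)%:E)%E.
have L0 : (0 <= L)%E by apply: integral_ge0 => x _; rewrite lee_fin oneDsqrV_ge0.
have Lfin : L \is a fin_num by rewrite ge0_fin_numE// integral_oneDsqrV_lty.
pose k := K ^+ 2 * (2 + 2 * w0 ^+ 2).
have k0 : 0 <= k.
  by rewrite mulr_ge0 ?sqr_ge0// addr_ge0// mulr_ge0// sqr_ge0.
rewrite /is_fourier.
apply: (@squeeze_cvge _ _ _ _ (cst 0%E) _ (fun T => (expR (- T) * (k * fine L))%:E)).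
- near=> T; apply/andP; split; first by apply: integral_ge0 => w _; rewrite lee_fin sqr_ge0.
  have T0 : 0 < T by near: T; exact: nbhs_pinfty_gt.
  have kT : 0 <= expR (- T) * k by rewrite mulr_ge0// expR_ge0.
  rewrite mulrA EFinM fineK// -integral_scaled_oneDsqrV//.
  apply: ge0_le_integral_subset => // [w _|w _|w _].
  + by rewrite lee_fin sqr_ge0.
  + rewrite lee_fin (fourier_trunc_causal w0 w pN T0) opprB addrC subrK.
    rewrite normcM normc_damped.
    apply: (@le_trans _ _
      ((expR (- (2 * T)) * (K * expR T * (normc (zpole w0 w))^-1)) ^+ 2)).
      rewrite ler_pXn2r ?nnegrE ?mulr_ge0 ?expR_ge0 ?normc_nneg ?invr_ge0 ?normc_nneg//.
      by rewrite ler_wpM2l ?expR_ge0// KP// ltW.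
    rewrite (_ : _ ^+ 2 = (expR (- (2 * T)) * expR T) ^+ 2 * K ^+ 2
      * (normc (zpole w0 w) ^+ 2)^-1); last by rewrite -exprVn; ring.
    rewrite -mulrA -[leRHS]mulrA; apply: ler_pM.
    * by rewrite sqr_ge0.
    * by rewrite mulr_ge0 ?sqr_ge0// invr_ge0 sqr_ge0.
    (* The left-hand side equals [e^(-2T)]; the weaker rate [e^(-T)] suffices for convergence to
       0. *)
    * by rewrite -expRD -expRM_natl ler_expR; lra.
    * rewrite /k -[leRHS]mulrA ler_wpM2l ?sqr_ge0//; exact: normc_zpoleV_le.
  + by rewrite lee_fin mulr_ge0 ?oneDsqrV_ge0.
- exact: cvg_cst.
- apply/cvg_EFin; first by near=> T.
  by rewrite -[0](mul0r (k * fine L)); apply: cvgMr_tmp; exact: cvgr_expR.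
Unshelve. all: by end_near. Qed.

Lemma H2_lap p N w0 : (size p <= N)%N ->
  H2 (fun w => (lap p N (zpole w0 w)).[0]).
Proof.
move=> pN; split; last first.
  exists (causal_signal p w0); split.
  - exact: square_integrable_causal.
  - by move=> t t0; rewrite /causal_signal t0.
  - exact: is_fourier_causal.
have cl : contC (fun w => (lap p N (zpole w0 w)).[0]).
  (* Seen as a polynomial in [1 / zpole w0 w], the function is continuous. *)
  have -> : (fun w => (lap p N (zpole w0 w)).[0]) =
      (fun w => (\sum_(i < N) (p^`(i)).[0] *: 'X^(i.+1)).[(zpole w0 w)^-1]).
    apply/funext => w; rewrite /lap !horner_sum; apply: eq_bigr => i _.
    by rewrite !hornerZ hornerXn mulrC.
  by apply: contC_horner; exact: contC_zpoleV.
have [m1 m2] := measurable_contC cl.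
split=> //; have [K K0 KP] := normc_lap_le p N w0.
pose k := K ^+ 2 * (2 + 2 * w0 ^+ 2).
have k0 : 0 <= k.
  by rewrite mulr_ge0 ?sqr_ge0// addr_ge0// mulr_ge0// sqr_ge0.
apply: (@le_lt_trans _ _ (\int[lambda]_x (k * (oneDsqr x)^-1)%:E)%E); last first.
  rewrite integral_scaled_oneDsqrV// lte_mul_pinfty//.
  exact: integral_oneDsqrV_lty.
apply: ge0_le_integral_subset => // [w _|w _|w _].
+ by rewrite lee_fin sqr_ge0.
+ rewrite lee_fin /k -mulrA.
  apply: (@le_trans _ _ ((K * (normc (zpole w0 w))^-1) ^+ 2)).
    rewrite ler_pXn2r ?nnegrE ?mulr_ge0 ?normc_nneg ?invr_ge0 ?normc_nneg//.
    by have := KP w 0 (lexx _); rewrite expR0 mulr1.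
  by rewrite exprMn exprVn ler_wpM2l ?sqr_ge0// normc_zpoleV_le.
+ by rewrite lee_fin mulr_ge0 ?oneDsqrV_ge0.
Qed.

(** Partial fractions at a single pole: once [Q] is expanded in powers of [z = s - j w0 + 2], the
    quotient is a combination of the [z^-(i+1)], each the Laplace transform of [t^i / i!]. *)
Lemma H2_rational Q N w0 : (size Q <= N)%N ->
  H2 (fun w => Q.[0 +i* w] / zpole w0 w ^+ N).
Proof.
move=> QN; pose q := Q \Po ('X + (-2 +i* w0)%:P).
have qN : (size q <= N)%N.
  apply: leq_trans QN; rewrite size_comp_poly2// size_XaddC//.
(* Division by [z ^+ N] reverses the coefficients: [z^-(i+1)] comes from the term of degree
   [N - 1 - i] of [q]. *)
pose p := \poly_(i < N) (q`_(N.-1 - i) / (i`!)%:R).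
have -> : (fun w => Q.[0 +i* w] / zpole w0 w ^+ N) =
    (fun w => (lap p N (zpole w0 w)).[0]).
  apply/funext => w; set z := zpole w0 w.
  have -> : Q.[0 +i* w] = q.[z].
    rewrite /q horner_comp !hornerE; congr (Q.[_]).
    by apply/eqP; rewrite eq_complex/=; apply/andP; split; apply/eqP; ring.
  rewrite (horner_coef_wide _ qN) mulr_suml /lap horner_sum.
  rewrite (reindex_inj rev_ord_inj)/=; apply: eq_bigr => i _.
  rewrite hornerZ horner_coef0 coef_derivn addn0 ffactnn coef_poly ltn_ord.
  have z0 : z != 0 by exact: zpole_neq0.
  have -> : q`_(N.-1 - i) / (i`!)%:R *+ i`! = q`_(N.-1 - i).
    by rewrite -mulr_natr divfK// pnatr_eq0 -lt0n fact_gt0.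
  have -> : (N.-1 - i = N - i.+1)%N by rewrite -predn_sub -subnS.
  rewrite -[X in _ / z ^+ X](subnK (ltn_ord i)) exprD.
  by rewrite exprVn; field; rewrite !expf_neq0.
exact/H2_lap/size_poly.
Qed.

End hardy_rational.

(** * Poles on the imaginary axis *)

Section lowest_terms.
Local Open Scope complex_scope.
Import ComplexField.Normc.
Context {R : realType}.
Local Notation C := R[i].
Local Notation lambda := (@lebesgue_measure R).

Lemma freqresp_lowest_terms (P : ratfun R) : exists n d : {poly C},
  [/\ d != 0, coprimep n d &
      forall w : R, freqresp P w = n.[0 +i* w] / d.[0 +i* w]].
Proof.
pose num := (frac (repr P)).1; pose den := (frac (repr P)).2.
have den0 : den != 0 by exact: denom_ratioP.
have g0 : gcdp num den != 0 by rewrite gcdp_eq0 negb_and den0 orbT.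
exists (map_poly (real_complex R) (num %/ gcdp num den)).
exists (map_poly (real_complex R) (den %/ gcdp num den)); split.
- by rewrite map_poly_eq0 dvdp_div_eq0 ?dvdp_gcdr.
- rewrite coprimep_map; apply: coprimep_div_gcd; by rewrite den0 orbT.
- by [].
Qed.

Lemma contC_imag : contC (fun w : R => 0 +i* w).
Proof. by split => w /=; [exact: cst_continuous|exact: cvg_id]. Qed.

Lemma open_null_eq0 (U : set R) : open U -> lambda.-negligible U -> U = set0.
Proof.
move=> oU nU; apply/eqP/negPn/negP => /set0P[x Ux].
have /nbhs_ballP[e /= e0 eU] := open_nbhs_nbhs (conj oU Ux).
have : lambda.-negligible (ball x e) by exact: negligibleS nU.
move/negligibleP => /(_ (measurable_ball _ _)) b0.
have := lebesgue_measure_ball x (ltW e0); rewrite [LHS]b0 => /esym/eqP.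
by rewrite eqe mulrn_eq0/= gt_eqF.
Qed.

Lemma finite_roots_imag (d : {poly C}) : d != 0 ->
  finite_set [set w : R | d.[0 +i* w] = 0].
Proof.
move=> d0; pose rs := undup (map (@complex.Im R) (sval (closed_field_poly_normal d))).
apply: (@sub_finite_set _ _ [set` rs]); last exact: finite_seq.
move=> w /= dw; rewrite mem_undup; apply/mapP; exists (0 +i* w) => //.
case: (closed_field_poly_normal d) => r /= dE.
have : root d (0 +i* w) by rewrite /root dw.
by rewrite dE rootZ ?lead_coef_eq0// root_prod_XsubC.
Qed.

(** An essential bound [K] gives [|n|^2 <= K^2 |d|^2] almost everywhere on the axis, hence
    everywhere by continuity. A zero of [d] there would be a zero of [n], against coprimality. *)
Lemma RLinfty_no_pole (P : ratfun R) (n d : {poly C}) :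
  RLinfty P -> d != 0 -> coprimep n d ->
  (forall w : R, freqresp P w = n.[0 +i* w] / d.[0 +i* w]) ->
  forall w : R, d.[0 +i* w] != 0.
Proof.
move=> PL d0 cnd PE w.
have [K PK] : exists K : R, {ae lambda, forall w, normc (freqresp P w) <= K}.
  have := ess_sup_ge lambda (fun w : R => (normc (freqresp P w))%:E).
  move: PL; rewrite /RLinfty/=; case: ess_sup => [K _|//|_] h.
    by exists K; apply: filterS h => x; rewrite lee_fin.
  (* If the essential supremum is [-oo], the modulus is below [-oo] almost everywhere and any
     constant serves. *)
  by exists 0; apply: filterS h => x.
pose h w : R := normc n.[0 +i* w] ^+ 2 - K ^+ 2 * normc d.[0 +i* w] ^+ 2.
have ch : continuous h.
  move=> x; apply: cvgB; first exact: (contC_normc (contC_horner n contC_imag)).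
  by apply: cvgM; [exact: cst_continuous|
    exact: (contC_normc (contC_horner d contC_imag))].
have oU : open [set w | 0 < h w].
  apply: (@open_comp _ _ h [set y | 0 < y]) => [x _|]; [exact: ch|exact: open_gt].
have U0 : [set w | 0 < h w] = set0.
  apply: open_null_eq0 => //.
  (* The roots of [d] are set apart, since there [freqresp] is 0 by the convention on division and
     says nothing about [n]; they are finitely many. *)
  apply: (@negligibleS _ _ _ lambda
     ([set w | ~ normc (freqresp P w) <= K] `|` [set w | d.[0 +i* w] = 0])).
    move=> x /= hx; have [dx|dx] := pselect (d.[0 +i* x] = 0); first by right.
    left=> PKx; move: hx; apply/negP; rewrite -leNgt subr_le0.
    have dx0 : d.[0 +i* x] != 0 by apply/eqP.
    rewrite -[n.[_]](divfK dx0) -PE normcM exprMn ler_wpM2r ?sqr_ge0//.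
    by rewrite ler_pXn2r ?nnegrE ?normc_nneg// (le_trans (normc_nneg _) PKx).
  apply: negligibleU; first by [].
  apply/negligibleP; last first.
    exact/countable_lebesgue_measure0/finite_set_countable/finite_roots_imag.
  exact/countable_measurable/finite_set_countable/finite_roots_imag.
apply/negP => /eqP dw0.
have hw : h w <= 0.
  by rewrite leNgt; apply/negP => hw; have : set0 w by rewrite -U0.
move: hw; rewrite /h dw0 normc0 expr0n mulr0 subr0 => nw.
have nw0 : n.[0 +i* w] = 0.
  apply: eq0_normc; apply/eqP; rewrite -sqrf_eq0 eq_le nw.
  exact: sqr_ge0.
have := coprimep_root cnd (_ : root n (0 +i* w)).
by rewrite /root nw0 eqxx => /(_ isT); rewrite dw0 eqxx.
Qed.

Lemma RLinfty_fraction (P : ratfun R) : RLinfty P -> exists n d : {poly C},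
  (forall w : R, d.[0 +i* w] != 0) /\
  forall w : R, freqresp P w = n.[0 +i* w] / d.[0 +i* w].
Proof.
move=> PL; have [n [d [d0 cnd PE]]] := freqresp_lowest_terms P.
by exists n, d; split=> //; exact: RLinfty_no_pole cnd PE.
Qed.

End lowest_terms.

(** * A lower bound for the gap *)

Section gap_lower_bound.
Local Open Scope complex_scope.
Import ComplexField.Normc.
Context {R : realType}.
Local Notation C := R[i].
Local Notation lambda := (@lebesgue_measure R).
Implicit Types (f g : R -> C) (x y : @sigpair R) (G : set (@sigpair R)).

Lemma measurable_normc_sqr f : square_integrable f ->
  measurable_fun setT (fun w => normc (f w) ^+ 2).
Proof.
move=> [m1 m2 _]; under eq_fun do rewrite normc_sqr.
by apply: measurable_funD; exact: measurable_funX.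
Qed.

Lemma integrable_normc_sqr f : square_integrable f ->
  lambda.-integrable setT (EFin \o (fun w => normc (f w) ^+ 2)).
Proof.
move=> sf; apply/integrableP; split.
  by apply/measurable_EFinP; exact: measurable_normc_sqr.
have [_ _] := sf; apply: le_lt_trans.
by apply: ge0_le_integral_subset => // w _; rewrite ?lee_fin ?sqr_ge0//= ger0_norm ?sqr_ge0.
Qed.

Lemma normc_sqrB_le (a b : C) :
  normc (a - b) ^+ 2 <= 2 * (normc a ^+ 2 + normc b ^+ 2).
Proof.
rewrite !normc_sqr Re_add Im_add Re_opp Im_opp.
have := sqr_ge0 (complex.Re a + complex.Re b).
have := sqr_ge0 (complex.Im a + complex.Im b); nra.
Qed.

Lemma square_integrableB f g : square_integrable f -> square_integrable g ->
  square_integrable (f - g).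
Proof.
move=> sf sg; have [f1 f2 _] := sf; have [g1 g2 _] := sg; split.
- have := measurable_funB f1 g1; congr measurable_fun.
  by apply/funext => w /=; rewrite -Re_opp -Re_add.
- have := measurable_funB f2 g2; congr measurable_fun.
  by apply/funext => w /=; rewrite -Im_opp -Im_add.
have := integrableD measurableT (integrable_normc_sqr sf) (integrable_normc_sqr sg).
move=> /(integrableZl measurableT 2) /integrableP[_]; apply: le_lt_trans.
apply: ge0_le_integral_subset => // w _; first by rewrite lee_fin sqr_ge0.
rewrite /= ger0_norm ?mulr_ge0 ?addr_ge0 ?sqr_ge0// lee_fin.
exact: normc_sqrB_le.
Qed.

(** Dominated by [|f|^2 + |g|^2]. *)
Lemma integrable_Re_mul_conj f g : square_integrable f -> square_integrable g ->
  lambda.-integrable setT (EFin \o (fun w => complex.Re (f w * (g w)^*))).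
Proof.
move=> sf sg; have [f1 f2 _] := sf; have [g1 g2 _] := sg.
have e w : complex.Re (f w * (g w)^*) = complex.Re (f w) * complex.Re (g w) +
    complex.Im (f w) * complex.Im (g w).
  by rewrite Re_mul; case: (g w) => a b /=; ring.
apply: le_integrable (integrableD measurableT
  (integrable_normc_sqr sf) (integrable_normc_sqr sg)) => //.
- apply/measurable_EFinP; under eq_fun do rewrite e.
  by apply: measurable_funD; exact: measurable_funM.
- move=> w _; rewrite /= lee_fin e [leRHS]ger0_norm ?addr_ge0 ?sqr_ge0//.
  rewrite !normc_sqr ler_norml; apply/andP; split.
  + have := sqr_ge0 (complex.Re (f w) + complex.Re (g w)).
    have := sqr_ge0 (complex.Im (f w) + complex.Im (g w)).
    have := sqr_ge0 (complex.Re (f w)); have := sqr_ge0 (complex.Im (f w)).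
    have := sqr_ge0 (complex.Re (g w)); have := sqr_ge0 (complex.Im (g w)); nra.
  + have := sqr_ge0 (complex.Re (f w) - complex.Re (g w)).
    have := sqr_ge0 (complex.Im (f w) - complex.Im (g w)).
    have := sqr_ge0 (complex.Re (f w)); have := sqr_ge0 (complex.Im (f w)).
    have := sqr_ge0 (complex.Re (g w)); have := sqr_ge0 (complex.Im (g w)); nra.
Qed.

Definition energy x (w : R) : R := normc (x.1 w) ^+ 2 + normc (x.2 w) ^+ 2.

Definition L2pair x := square_integrable x.1 /\ square_integrable x.2.

Lemma energy_ge0 x w : 0 <= energy x w.
Proof. by rewrite addr_ge0 ?sqr_ge0. Qed.

Lemma measurable_energy x : L2pair x -> measurable_fun setT (energy x).
Proof. by move=> [s1 s2]; apply: measurable_funD; exact: measurable_normc_sqr. Qed.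

Lemma L2pairB x y : L2pair x -> L2pair y -> L2pair (x - y).
Proof. by move=> [x1 x2] [y1 y2]; split; exact: square_integrableB. Qed.

Lemma integrable_energy x : L2pair x -> lambda.-integrable setT (EFin \o energy x).
Proof.
move=> [s1 s2]; exact: (integrableD measurableT
  (integrable_normc_sqr s1) (integrable_normc_sqr s2)).
Qed.

Lemma integral_energy x : L2pair x ->
  (\int[lambda]_w (energy x w)%:E = (norm2 x ^+ 2)%:E)%E.
Proof.
move=> sx; rewrite /norm2 sqr_sqrtr; last first.
  by apply: Rintegral_ge0 => w _; exact: energy_ge0.
by rewrite fineK//; exact: integrable_fin_num (integrable_energy sx).
Qed.

Lemma Re_inner x y : L2pair x -> L2pair y -> complex.Re (inner x y) =
  \int[lambda]_w complex.Re (x.1 w * (y.1 w)^*) +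
  \int[lambda]_w complex.Re (x.2 w * (y.2 w)^*).
Proof.
move=> [x1 x2] [y1 y2]; rewrite /inner/= -RintegralD//; last 2 first.
- exact: integrable_Re_mul_conj.
- exact: integrable_Re_mul_conj.
by apply: eq_Rintegral => w _; rewrite -Re_add.
Qed.

(** The squared norm of [x - y] is the real part of [inner (x - y) x - inner (x - y) y]. *)
Lemma inner0_norm2 x y : L2pair x -> L2pair y ->
  inner (x - y) x = 0 -> inner (x - y) y = 0 -> norm2 (x - y) = 0.
Proof.
move=> sx sy xy1 xy2; have sxy := L2pairB sx sy.
have [x1 x2] := sx; have [y1 y2] := sy; have [xy_1 xy_2] := sxy.
have h1 := congr1 (@complex.Re R) xy1; have h2 := congr1 (@complex.Re R) xy2.
rewrite Re_inner//= in h1; rewrite Re_inner//= in h2.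
rewrite /norm2; apply/eqP; rewrite sqrtr_eq0 RintegralD//; last 2 first.
- exact: integrable_normc_sqr.
- exact: integrable_normc_sqr.
have e f g : square_integrable f -> square_integrable g ->
    \int[lambda]_w normc ((f - g) w) ^+ 2 =
    \int[lambda]_w complex.Re ((f - g) w * (f w)^*) -
    \int[lambda]_w complex.Re ((f - g) w * (g w)^*).
  move=> sf sg; have sfg := square_integrableB sf sg.
  rewrite -RintegralB//; last 2 first.
  - exact: integrable_Re_mul_conj.
  - exact: integrable_Re_mul_conj.
  apply: eq_Rintegral => w _; rewrite normc_sqr /=.
  rewrite (_ : (f - g) w = f w - g w)//.
  by case: (f w) (g w) => a b [c d] /=; ring.
rewrite !e//; lra.
Qed.

Lemma L2pair_graph (P : ratfun R) x : graph P x -> L2pair x.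
Proof. by move=> [[[? _] [? _]] _]. Qed.

Lemma energy_eq0 x w : energy x w = 0 -> x.1 w = 0 /\ x.2 w = 0.
Proof.
move=> /eqP; rewrite paddr_eq0 ?sqr_ge0// !sqrf_eq0 => /andP[/eqP h1 /eqP h2].
by split; exact: eq0_normc.
Qed.

(** As [x] is a projection of itself, [proj] does select a projection; the difference from [x] is
    orthogonal to both and so has norm 0. The choice among representatives leaves only equality
    almost everywhere. *)
Lemma proj_id G x : (forall y, G y -> L2pair y) -> G x ->
  {ae lambda, forall w, x.1 w = (Defs.proj G x).1 w /\ x.2 w = (Defs.proj G x).2 w}.
Proof.
move=> GL Gx; set y := Defs.proj G x.
have [Gy yP] : is_proj G x y.
  apply: (@xgetPex _ _ (is_proj G x)); exists x; split=> // g _.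
  rewrite subrr /inner (_ : (fun w => _) = (fun=> 0)).
    by rewrite /Cintegral !Rintegral_cst// mul0r.
  by apply/funext => w /=; rewrite !mul0r addr0.
have sxy := L2pairB (GL _ Gx) (GL _ Gy).
have n0 : norm2 (x - y) = 0.
  by apply: inner0_norm2; [exact: GL|exact: GL|exact: yP|exact: yP].
have := integral_energy sxy; rewrite n0 expr0n/= => i0.
have : ae_eq lambda setT (EFin \o energy (x - y)) (cst 0%E).
  apply/ae_eq_integral_abs => //.
    by apply/measurable_EFinP; exact: measurable_energy.
  apply: (eq_trans _ i0); apply: eq_integral => w _ /=.
  by rewrite ger0_norm// energy_ge0.
apply: filterS => w /(_ I) [/energy_eq0 [h1 h2]].
by split; apply/eqP; rewrite -subr_eq0; apply/eqP; [exact: h1|exact: h2].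
Qed.

Lemma H2_0 : H2 (0 : R -> C).
Proof.
have := @H2_rational R 0 0 0; rewrite size_poly0 => /(_ isT).
by congr H2; apply/funext => w; rewrite horner0 mul0r.
Qed.

Lemma graph0 (P : ratfun R) : graph P 0.
Proof.
split; first by split; exact: H2_0.
by apply: aeW => w; rewrite mulr0.
Qed.

(* If the projection does not exist, [proj] takes the default value 0. *)
Lemma proj_in G x : G 0 -> G (Defs.proj G x).
Proof. by move=> G0; rewrite /Defs.proj; case: xgetP => // y _ []. Qed.

(** The gap is tested on [x], which its projection onto [graph P1] leaves unchanged almost
    everywhere; the other projection lies in [graph P2], so the pointwise hypothesis applies and is
    integrated. The number [s] is the norm of the difference of the projections, kept as a real
    because the gap is an extended real. *)
Lemma gap_lower_bound (P1 P2 : ratfun R) x (k : R -> R) :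
  measurable_fun setT k -> (forall w, 0 <= k w) ->
  (forall w a v, k w * (normc a ^+ 2 + normc (freqresp P1 w * a) ^+ 2) <=
     normc (a - v) ^+ 2 + normc (freqresp P1 w * a - freqresp P2 w * v) ^+ 2) ->
  graph P1 x -> norm2 x <= 1 ->
  exists s : R, [/\ 0 <= s, (s%:E <= gap P1 P2)%E &
    (\int[lambda]_w (k w * energy x w)%:E <= (s ^+ 2)%:E)%E].
Proof.
move=> mk k0 kP Gx x1.
pose y := Defs.proj (graph P1) x; pose g := Defs.proj (graph P2) x.
have Gy : graph P1 y by apply: proj_in; exact: graph0.
have Gg : graph P2 g by apply: proj_in; exact: graph0.
have sx := L2pair_graph Gx; have sy := L2pair_graph Gy.
have sg := L2pair_graph Gg; have syg := L2pairB sy sg.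
exists (norm2 (y - g)); split.
- exact: sqrtr_ge0.
- by apply: ereal_sup_ubound; exists x => //; split => //; case: Gx.
rewrite -integral_energy//; apply: ae_ge0_le_integral => //.
- by move=> w _; rewrite lee_fin mulr_ge0 ?energy_ge0.
- by apply/measurable_EFinP; apply: measurable_funM => //; exact: measurable_energy.
- by move=> w _; rewrite lee_fin energy_ge0.
- by apply/measurable_EFinP; exact: measurable_energy.
have ae1 := proj_id (@L2pair_graph P1) Gx.
have [_ ae2] := Gy; have [_ ae3] := Gg.
move: ae1 ae2 ae3; apply: filterS3; first exact: (ae_filter_ringOfSetsType lambda).
move=> w [e1 e2] e3 e4 _.
rewrite lee_fin /energy e1 e2 -/y (_ : (y - g).1 w = y.1 w - g.1 w)//.
rewrite (_ : (y - g).2 w = y.2 w - g.2 w)// e3 e4; exact: kP.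
Qed.

End gap_lower_bound.

(** * Concentration at a frequency *)

Section concentration.
Context {R : realType}.
Local Notation lambda := (@lebesgue_measure R).

Lemma bernoulli_ineq (h : R) k : 0 <= h -> 1 + k%:R * h <= (1 + h) ^+ k.
Proof.
move=> h0; elim: k => [|k ih]; first by rewrite mul0r addr0 expr0.
rewrite exprS -natr1; have : 0 <= k%:R * h * h by rewrite !mulr_ge0.
have := ler_wpM2l (_ : 0 <= 1 + h) ih; rewrite addr_ge0// => /(_ isT); nra.
Qed.

(** The squared modulus of [1 / (s - j w0 + 2)] at [s = jw], largest at [w = w0]. *)
Definition peak (w0 w : R) : R := (4 + (w - w0) ^+ 2)^-1.

Lemma peak_gt0 w0 w : 0 < peak w0 w.
Proof. by rewrite invr_gt0 ltr_wpDr// sqr_ge0. Qed.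

Lemma peak_ge0 w0 w : 0 <= peak w0 w.
Proof. exact/ltW/peak_gt0. Qed.

Lemma continuous_peak w0 : continuous (peak w0).
Proof.
move=> w; apply: cvgV; first by rewrite gt_eqF// ltr_wpDr// sqr_ge0.
apply: cvgD; first exact: cst_continuous.
by under eq_fun do rewrite expr2; apply: cvgM; apply: cvgB;
  by [exact: cvg_id|exact: cst_continuous].
Qed.

Lemma continuous_exprn (f : R -> R) k : continuous f -> continuous (fun w => f w ^+ k).
Proof.
move=> cf; elim: k => [|k ih] w; first exact: cst_continuous.
by under eq_fun do rewrite exprS; apply: cvgM; [exact: cf|exact: ih].
Qed.

Lemma le_peak w0 w e : `|w - w0| <= e -> (4 + e ^+ 2)^-1 <= peak w0 w.
Proof.
move=> we; have e0 : 0 <= e by exact: le_trans we.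
rewrite lef_pV2 ?posrE ?ltr_wpDr ?sqr_ge0// lerD2l.
by rewrite -[leLHS]real_normK ?num_real// ler_pXn2r ?nnegrE.
Qed.

Lemma peak_le w0 w e : 0 <= e -> e <= `|w - w0| -> peak w0 w <= (4 + e ^+ 2)^-1.
Proof.
move=> e0 we; rewrite lef_pV2 ?posrE ?ltr_wpDr ?sqr_ge0// lerD2l.
by rewrite -[leRHS]real_normK ?num_real// ler_pXn2r ?nnegrE.
Qed.

Lemma integrable_mul_peakX (F : R -> R) w0 k : continuous F ->
  lambda.-integrable setT (EFin \o F) ->
  lambda.-integrable setT (EFin \o (fun w => F w * peak w0 w ^+ k)).
Proof.
move=> cF iF; apply: le_integrable iF => //.
  apply/measurable_EFinP; apply: continuous_measurable_fun => w.
  by apply: cvgM; [exact: cF|exact: (@continuous_exprn (peak w0) k (@continuous_peak w0) w)].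
move=> w _; rewrite lee_fin normrM ler_piMr// ger0_norm ?exprn_ge0 ?peak_ge0//.
rewrite exprn_ile1 ?peak_ge0// (le_trans (peak_le (lexx 0) (normr_ge0 _)))//.
by rewrite expr0n addr0 invf_le1//; lra.
Qed.

(* At distance at least [e] from [w0], [peak w0 ^+ k] is at most [b ^+ k], while
   it is at least [a ^+ k] at distance at most [e / 2], with [b < a]. *)
Lemma le0_of_integral_peakX_le0 (F : R -> R) w0 : continuous F ->
  lambda.-integrable setT (EFin \o F) ->
  (forall k, \int[lambda]_w (F w * peak w0 w ^+ k) <= 0) -> F w0 <= 0.
Proof.
move=> cF iF Fk; rewrite leNgt; apply/negP => F0.
pose c := F w0 / 2; have c0 : 0 < c by rewrite divr_gt0.
have [e e0 eF] : exists2 e, 0 < e & forall w, `|w - w0| < e -> c <= F w.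
  have : nbhs w0 [set w | c < F w].
    by apply: (cvgr_gt _ (cF w0)); rewrite /c; lra.
  move=> /nbhs_ballP[e /= e0 eP]; exists e => // w we.
  by apply/ltW/eP; rewrite /ball/= distrC.
pose a := (4 + (e / 2) ^+ 2)^-1; pose b := (4 + e ^+ 2)^-1.
have b0 : 0 < b by rewrite invr_gt0 ltr_wpDr// sqr_ge0.
have ba : b < a.
  have p4 (x : R) : 0 < 4 + x ^+ 2 by rewrite ltr_wpDr// sqr_ge0.
  by rewrite ltf_pV2 ?posrE ?p4// ltrD2l; nra.
have a0 : 0 < a by exact: lt_trans ba.
pose A : set R := `[w0 - e / 2, w0 + e / 2]%classic.
have muA : lambda A = e%:E.
  rewrite lebesgue_measure_itv/= lte_fin ifT; last by lra.
  by rewrite -EFinB; congr EFin; lra.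
have iA : lambda.-integrable setT (EFin \o (\1_A : R -> R)).
  exact: integrable_indic_itv.
have iAA : \int[lambda]_w (\1_A w : R) = e.
  have mA : measurable A by exact: measurable_itv.
  rewrite /Rintegral (integral_indic lambda measurableT mA) setIT; exact: (congr1 fine muA).
have iaF : lambda.-integrable setT (EFin \o (fun w => `|F w|)).
  exact: integrable_norm iF.
pose L := \int[lambda]_w `|F w|.
(* Integration of the pointwise bound [F peak^k >= c a^k 1_A - b^k |F|], where [A] has length
   [e]. *)
have key k : c * a ^+ k * e <= b ^+ k * L.
  rewrite -subr_le0; apply: le_trans (Fk k).
  rewrite -iAA -!RintegralZl// -RintegralB//; last 2 first.
  - exact: (integrableZl measurableT (c * a ^+ k) iA).
  - exact: (integrableZl measurableT (b ^+ k) iaF).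
  apply: le_Rintegral => //.
  - exact: (integrableB measurableT (integrableZl measurableT (c * a ^+ k) iA)
      (integrableZl measurableT (b ^+ k) iaF)).
  - exact: integrable_mul_peakX.
  move=> w _; have r0 : 0 < peak w0 w ^+ k by rewrite exprn_gt0// peak_gt0.
  have bF : 0 <= b ^+ k * `|F w| by rewrite mulr_ge0// exprn_ge0// ltW.
  rewrite indicE; have [/set_mem|/negP] := boolP (w \in A).
    rewrite /A/= in_itv/= mulr1 => wA.
    have wA' : `|w - w0| <= e / 2 by rewrite ler_distl; lra.
    have cFw : c <= F w by apply: eF; apply: le_lt_trans wA' _; lra.
    apply: (@le_trans _ _ (c * a ^+ k)); first by lra.
    apply: ler_pM => //; rewrite ?exprn_ge0 ?(ltW a0) ?(ltW c0)//.
    by apply: lerXn2r; rewrite ?nnegrE ?peak_ge0 ?(ltW a0)//; exact: le_peak.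
  move=> _; rewrite mulr0 sub0r.
  have [we|we] := ltP `|w - w0| e.
    apply: (@le_trans _ _ 0); first by rewrite oppr_le0.
    by rewrite mulr_ge0 ?(ltW r0)// (le_trans (ltW c0) (eF _ we)).
  apply: (@le_trans _ _ (- (peak w0 w ^+ k * `|F w|))).
    rewrite lerN2 ler_wpM2r//; apply: lerXn2r; rewrite ?nnegrE ?peak_ge0 ?(ltW b0)//.
    by apply: peak_le => //; exact: ltW.
  rewrite mulrC -mulNr ler_wpM2r ?(ltW r0)//.
  by rewrite lerNl -normrN ler_norm.
(* Since [(a / b)^k = (1 + h)^k >= 1 + k h], the bound [key] keeps [k h] below a constant, which
   fails for large [k]. *)
pose h := a / b - 1.
have h0 : 0 < h by rewrite subr_gt0 ltr_pdivlMr// mul1r.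
have key2 k : c * e * (k%:R * h) <= L.
  have := key k; rewrite -[a](divfK (lt0r_neq0 b0)) (_ : a / b = 1 + h); last first.
    by rewrite /h; ring.
  rewrite exprMn (_ : _ * e = b ^+ k * (c * e * (1 + h) ^+ k)); last by ring.
  rewrite ler_pM2l ?exprn_gt0// => kL; apply: le_trans kL.
  rewrite ler_wpM2l ?(ltW (mulr_gt0 c0 e0))//.
  by apply: (le_trans _ (bernoulli_ineq k (ltW h0))); lra.
have ceh : 0 < c * e * h by rewrite !mulr_gt0.
have := key2 (Num.truncn (L / (c * e * h))).+1.
by apply/negP; rewrite -ltNge mulrCA -ltr_pdivrMr// truncnS_gt.
Qed.

End concentration.

(** * Chordal distance and gap *)

Section chordal_le_gap.
Local Open Scope complex_scope.
Import ComplexField.Normc.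
Context {R : realType}.
Local Notation C := R[i].
Local Notation lambda := (@lebesgue_measure R).

(** The classical chordal formula; the usual factor 4 is absent because the sphere has diameter
    1. *)
Lemma d_chord_sqr (a b : C) : d_chord (stereo_inv a) (stereo_inv b) ^+ 2 =
  normc (a - b) ^+ 2 * ((1 + normc a ^+ 2)^-1 * (1 + normc b ^+ 2)^-1).
Proof.
rewrite /d_chord sqr_sqrtr; last by apply: sumr_ge0 => i _; exact: sqr_ge0.
rewrite !big_ord_recr big_ord0 /= add0r /set_val/= !mxE/=.
have pa : 1 + normc a ^+ 2 != 0 by rewrite gt_eqF// ltr_wpDr// sqr_ge0.
have pb : 1 + normc b ^+ 2 != 0 by rewrite gt_eqF// ltr_wpDr// sqr_ge0.
move: pa pb; rewrite !normc_sqr Re_add Im_add Re_opp Im_opp => pa pb.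
by field; rewrite pa pb.
Qed.

Lemma d_chord_ge0 (r1 r2 : @sphere R) : 0 <= d_chord r1 r2.
Proof. exact: sqrtr_ge0. Qed.

(* With [X = p1 a - p2 v] and [Y = a - v], the left-hand side is
   [|X - p2 Y|^2 / (1 + |p2|^2)]: this is Cauchy-Schwarz. *)
Lemma d_chord_graph_le (p1 p2 a v : C) :
  d_chord (stereo_inv p1) (stereo_inv p2) ^+ 2
    * (normc a ^+ 2 + normc (p1 * a) ^+ 2)
  <= normc (a - v) ^+ 2 + normc (p1 * a - p2 * v) ^+ 2.
Proof.
rewrite d_chord_sqr (normcM p1) exprMn.
set m1 := normc p1; set m2 := normc p2; set na := normc a.
have p10 : 1 + m1 ^+ 2 != 0 by rewrite gt_eqF// ltr_wpDr// sqr_ge0.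
have p20 : 0 < 1 + m2 ^+ 2 by rewrite ltr_wpDr// sqr_ge0.
rewrite [leLHS](_ : _ = (normc (p1 - p2) * na) ^+ 2 / (1 + m2 ^+ 2)); last first.
  by field; rewrite p10 gt_eqF.
rewrite ler_pdivrMr// -normcM.
rewrite (_ : (p1 - p2) * a = (p1 * a - p2 * v) + - (p2 * (a - v))); last by ring.
have := le_normcD (p1 * a - p2 * v) (- (p2 * (a - v))).
rewrite normcN normcM -/m2; set X := normc (_ - _ * v); set Y := normc (a - v).
set Z := normc _ => ZXY.
have [X0 Y0 Z0 m20] : [/\ 0 <= X, 0 <= Y, 0 <= Z & 0 <= m2].
  by split; exact: normc_nneg.
apply: (@le_trans _ _ ((X + m2 * Y) ^+ 2)).
  by rewrite ler_pXn2r ?nnegrE// addr_ge0// mulr_ge0.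
have := sqr_ge0 (m2 * X - Y); nra.
Qed.

Section fractions.
Variables (P1 P2 : ratfun R) (n1 d1 n2 d2 : {poly C}) (w0 : R).
Hypothesis d1_neq0 : forall w : R, d1.[0 +i* w] != 0.
Hypothesis d2_neq0 : forall w : R, d2.[0 +i* w] != 0.
Hypothesis P1E : forall w : R, freqresp P1 w = n1.[0 +i* w] / d1.[0 +i* w].
Hypothesis P2E : forall w : R, freqresp P2 w = n2.[0 +i* w] / d2.[0 +i* w].

Let kappa2 w := d_chord (stereo_inv (freqresp P1 w)) (stereo_inv (freqresp P2 w)) ^+ 2.
Let G w : R := normc d1.[0 +i* w] ^+ 2 + normc n1.[0 +i* w] ^+ 2.
(** The maximum of the sizes makes both quotients below strictly proper, as [H2_rational] requires;
    the extra [k] sharpens the peak at [w0]. *)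
Let N k := (maxn (size d1) (size n1) + k)%N.

(** The test signal; the factor [c] serves to normalise it. *)
Let signal (c : R) k : @sigpair R :=
  (fun w => (c%:C *: d1).[0 +i* w] / zpole w0 w ^+ N k,
   fun w => (c%:C *: n1).[0 +i* w] / zpole w0 w ^+ N k).

Let continuous_kappa2 : continuous kappa2.
Proof.
have c1 : contC (fun w => freqresp P1 w : C).
  rewrite (_ : (fun _ => _) = (fun w => n1.[0 +i* w] * (d1.[0 +i* w])^-1)).
    apply: contCM; first exact: (contC_horner n1 contC_imag).
    by apply: contCV => //; exact: (contC_horner d1 contC_imag).
  by apply/funext => w; exact: P1E.
have c2 : contC (fun w => freqresp P2 w : C).
  rewrite (_ : (fun _ => _) = (fun w => n2.[0 +i* w] * (d2.[0 +i* w])^-1)).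
    apply: contCM; first exact: (contC_horner n2 contC_imag).
    by apply: contCV => //; exact: (contC_horner d2 contC_imag).
  by apply/funext => w; exact: P2E.
have c12 : contC (fun w => (freqresp P1 w : C) - freqresp P2 w).
  have [r1 i1] := c1; have [r2 i2] := c2; split => w.
  - under eq_fun do rewrite Re_add Re_opp.
    by apply: cvgB; [exact: r1|exact: r2].
  - under eq_fun do rewrite Im_add Im_opp.
    by apply: cvgB; [exact: i1|exact: i2].
have cV (f : R -> C) : contC f -> continuous (fun w => (1 + normc (f w) ^+ 2)^-1).
  move=> cf w; apply: cvgV; first by rewrite gt_eqF// ltr_wpDr// sqr_ge0.
  by apply: cvgD; [exact: cst_continuous|exact: (contC_normc cf)].
move=> w; rewrite /kappa2; under eq_fun do rewrite d_chord_sqr.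
apply: cvgM; first exact: (contC_normc c12).
by apply: cvgM; [exact: (cV _ c1)|exact: (cV _ c2)].
Qed.

Let continuous_G : continuous G.
Proof.
by move=> w; apply: cvgD; [exact: (contC_normc (contC_horner d1 contC_imag))|
  exact: (contC_normc (contC_horner n1 contC_imag))].
Qed.

Let G_gt0 w : 0 < G w.
Proof.
rewrite ltr_pwDl ?sqr_ge0// exprn_gt0// lt_def normc_nneg andbT.
by apply: contra (d1_neq0 w) => /eqP/eq0_normc ->.
Qed.

Let graph_signal c k : graph P1 (signal c k).
Proof.
have cs (p : {poly C}) : (size p <= N k)%N -> (size (c%:C *: p) <= N k)%N.
  exact/leq_trans/size_scale_leq.
split; last first.
  by apply: aeW => w; rewrite /= P1E !hornerZ; field;
    rewrite d1_neq0 expf_neq0// zpole_neq0.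
split; apply: H2_rational; apply: cs.
  by rewrite (leq_trans _ (leq_addr _ _))// leq_maxl.
by rewrite (leq_trans _ (leq_addr _ _))// leq_maxr.
Qed.

Let energy_signal c k w :
  energy (signal c k) w = c ^+ 2 * (G w * peak w0 w ^+ N k).
Proof.
rewrite /energy/= !hornerZ !normcM !normcV normcX normc_real /peak -normc_zpole.
rewrite !exprMn real_normK ?num_real// -mulrDl -mulrDr -mulrA; congr (_ * (_ * _)).
by rewrite !exprVn exprAC.
Qed.

Let integrable_Gpeak k :
  lambda.-integrable setT (EFin \o (fun w => G w * peak w0 w ^+ N k)).
Proof.
have := integrable_energy (L2pair_graph (graph_signal 1 k)).
apply: eq_integrable => // w _ /=.
by rewrite energy_signal expr1n mul1r.
Qed.

Let Gpeak_ge0 k w : 0 <= G w * peak w0 w ^+ N k.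
Proof. by rewrite mulr_ge0 ?exprn_ge0 ?peak_ge0// ltW. Qed.

Let kappa2_le1 w : kappa2 w <= 1.
Proof.
(* With [a = 1] and [v = 0], the right-hand side equals the factor of [kappa2 w] on the left. *)
have := d_chord_graph_le (freqresp P1 w) (freqresp P2 w) 1 0.
rewrite !mulr1 mulr0 !subr0 => h.
have p1 : 0 < normc (1 : C) ^+ 2 + normc (freqresp P1 w) ^+ 2.
  by rewrite normc1 expr1n ltr_pwDl// sqr_ge0.
by move: h; rewrite -ler_pdivlMr// divff// gt_eqF.
Qed.

Let norm2_signal c k : norm2 (signal c k) ^+ 2 =
  c ^+ 2 * \int[lambda]_w (G w * peak w0 w ^+ N k).
Proof.
have := congr1 fine (integral_energy (L2pair_graph (graph_signal c k))).
rewrite /= => <-; rewrite -RintegralZl//.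
by congr fine; apply: eq_integral => w _; rewrite energy_signal.
Qed.

Let integrable_kappa2 k : lambda.-integrable setT
  (EFin \o (fun w => kappa2 w * (G w * peak w0 w ^+ N k))).
Proof.
apply: le_integrable (integrable_Gpeak k) => //.
  apply/measurable_EFinP; apply: continuous_measurable_fun => w.
  apply: cvgM; first exact: continuous_kappa2.
  apply: cvgM; first exact: continuous_G.
  exact: (@continuous_exprn R (peak w0) (N k) (@continuous_peak _ w0) w).
move=> w _ /=; have h := Gpeak_ge0 k w; have k0 : 0 <= kappa2 w by exact: sqr_ge0.
by rewrite lee_fin (ger0_norm h) (ger0_norm (mulr_ge0 k0 h)) ler_piMl.
Qed.

Let integral_kappa2_le (g : R) k : gap P1 P2 = g%:E ->
  \int[lambda]_w (kappa2 w * (G w * peak w0 w ^+ N k)) <=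
  g ^+ 2 * \int[lambda]_w (G w * peak w0 w ^+ N k).
Proof.
move=> gE; set J := leLHS; set I := \int[_]_w _.
have I0 : 0 <= I by have := norm2_signal 1 k; rewrite expr1n mul1r -/I => <-; exact: sqr_ge0.
(* Normalisation divides by [I]; if [I = 0], the bound [kappa2 <= 1] gives the claim. *)
have [I_eq0|I_neq0] := eqVneq I 0.
  rewrite I_eq0 mulr0 -I_eq0; apply: le_Rintegral => // w _.
  by rewrite ler_piMl ?Gpeak_ge0 ?kappa2_le1.
have Igt0 : 0 < I by rewrite lt_def I_neq0.
pose c := (Num.sqrt I)^-1.
have c2 : c ^+ 2 = I^-1 by rewrite /c exprVn sqr_sqrtr.
have x1 : norm2 (signal c k) <= 1.
  by rewrite -(@ler_pXn2r _ 2) ?nnegrE ?sqrtr_ge0// expr1n norm2_signal c2 mulVf.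
have mk : measurable_fun setT kappa2 by exact: continuous_measurable_fun.
have [s [s0 sg sP]] := gap_lower_bound mk (fun w => sqr_ge0 _)
  (fun w a v => d_chord_graph_le _ _ a v) (graph_signal c k) x1.
have iE : (\int[lambda]_w (kappa2 w * energy (signal c k) w)%:E = (c ^+ 2 * J)%:E)%E.
  rewrite /J /Rintegral EFinM fineK; last first.
    exact: (integrable_fin_num measurableT (integrable_kappa2 k)).
  rewrite -integralZl//; last exact: integrable_kappa2.
  by apply: eq_integral => w _; rewrite energy_signal -EFinM mulrCA.
move: sP; rewrite iE lee_fin c2 ler_pdivrMl// mulrC => /le_trans; apply.
move: sg; rewrite gE lee_fin => sg.
by rewrite ler_wpM2r// ler_pXn2r// nnegrE// (le_trans s0).
Qed.

Lemma d_chord_le_gap_fractions :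
  ((d_chord (stereo_inv (freqresp P1 w0)) (stereo_inv (freqresp P2 w0)))%:E
    <= gap P1 P2)%E.
Proof.
have mk : measurable_fun setT kappa2 by exact: continuous_measurable_fun.
(* The zero signal shows that the gap is at least some [s >= 0], which excludes [-oo] and makes [g]
   nonnegative. *)
have n0 : norm2 (signal 0 0) <= 1.
  rewrite -(@ler_pXn2r _ 2) ?nnegrE ?sqrtr_ge0// expr1n.
  by rewrite norm2_signal expr0n mul0r.
have [s [s0 sg _]] := gap_lower_bound mk (fun w => sqr_ge0 _)
  (fun w a v => d_chord_graph_le _ _ a v) (graph_signal 0 0) n0.
case gE : (gap P1 P2) sg => [g| |]; rewrite ?leey// ?leeNy_eq// lee_fin => sg.
have g0 : 0 <= g by exact: le_trans sg.
rewrite lee_fin -(@ler_pXn2r _ 2) ?nnegrE ?d_chord_ge0// -/(kappa2 w0) -subr_le0.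
(* The exponent [N 0] makes [F] integrable; each further factor [peak w0 w ^+ k] turns it into
   [N k], where [integral_kappa2_le] applies. As [G] and [peak] are positive, [F w0 <= 0] is the
   claim. *)
pose F w := (kappa2 w - g ^+ 2) * (G w * peak w0 w ^+ N 0).
have : F w0 <= 0.
  have iF : lambda.-integrable setT (EFin \o F).
    rewrite (_ : EFin \o F = (EFin \o (fun w => kappa2 w * (G w * peak w0 w ^+ N 0)
      - g ^+ 2 * (G w * peak w0 w ^+ N 0)))); last first.
      by apply/funext => w /=; rewrite /F mulrBl.
    exact: (integrableB measurableT (integrable_kappa2 0)
      (integrableZl measurableT (g ^+ 2) (integrable_Gpeak 0))).
  apply: (@le0_of_integral_peakX_le0 R F w0) => // [w|k].
    apply: cvgM.
      by apply: cvgB; [exact: continuous_kappa2|exact: cst_continuous].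
    apply: cvgM; first exact: continuous_G.
    exact: (@continuous_exprn R (peak w0) (N 0) (@continuous_peak _ w0) w).
  have NE w : F w * peak w0 w ^+ k = kappa2 w * (G w * peak w0 w ^+ N k)
      - g ^+ 2 * (G w * peak w0 w ^+ N k).
    by rewrite /F /N addn0 exprD; ring.
  under eq_Rintegral do rewrite NE.
  have iG := integrable_Gpeak k.
  rewrite RintegralB//; last exact: (integrableZl measurableT (g ^+ 2) iG).
  by rewrite RintegralZl// subr_le0; exact: integral_kappa2_le.
by rewrite /F pmulr_lle0// mulr_gt0// exprn_gt0// peak_gt0.
Qed.

End fractions.
End chordal_le_gap.

Lemma d_chord_le_gap (R : realType) (P1 P2 : ratfun R) (w : R) :
  RLinfty P1 -> RLinfty P2 ->
  ((d_chord (stereo_inv (freqresp P1 w)) (stereo_inv (freqresp P2 w)))%:E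
    <= gap P1 P2)%E.
Proof.
move=> /RLinfty_fraction[n1 [d1 [d1_neq0 P1E]]].
move=> /RLinfty_fraction[n2 [d2 [d2_neq0 P2E]]].
exact: d_chord_le_gap_fractions d1_neq0 d2_neq0 P1E P2E.
Qed.

(** * Transport of couplings from the models to the sphere *)

Theorem theoremV3 (R : realType) (n p : nat)
  (M : set (model R n)) (m0 : M)
  (M_RLinfty : forall Sigma, M Sigma -> RLinfty (TF Sigma))
  (M_continuous : forall w : R, 0 <= w ->
     continuous (fun Sigma : M => Psi w (set_val Sigma)))
  (Theta1 Theta2 : set 'rV[R]_p) (t1 : Theta1) (t2 : Theta2)
  (ftheta1 : probability (borel_sub t1) R)
  (ftheta2 : probability (borel_sub t2) R)
  (Phi1 : {mfun borel_sub t1 >-> borel_sub m0})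
  (Phi2 : {mfun borel_sub t2 >-> borel_sub m0})
  (S1_convex_compact : forall w : R, 0 <= w ->
     convex_set (freq_supp ftheta1 (random_tf Phi1) w : set (convex_lmodType (Rcomplex R)))
     /\ compact (freq_supp ftheta1 (random_tf Phi1) w))
  (S2_convex_compact : forall w : R, 0 <= w ->
     convex_set (freq_supp ftheta2 (random_tf Phi2) w : set (convex_lmodType (Rcomplex R)))
     /\ compact (freq_supp ftheta2 (random_tf Phi2) w))
  (q : R) (q_ge1 : 1 <= q) :
  (d_q q ftheta1 (random_tf Phi1) ftheta2 (random_tf Phi2) <=
   dist_gap q (distribution ftheta1 Phi1) (distribution ftheta2 Phi2))%E.
Proof.
have suppC (f : probability (borel_sub m0) R) : f (~` supp f) = 0.
  apply: measure_supp_compl.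
  exact/second_countable_set_type/second_countable_model.
have msupp (f : probability (borel_sub m0) R) :
    measurable (supp f : set (borel_sub m0)).
  rewrite -[supp f]setCK; apply: measurableC; apply: sub_sigma_algebra.
  by apply: open_supp_compl => U; exact: measure_ge0.
apply: ge_ereal_sup => _ [w /= w0 <-].
apply: le_ereal_inf_tmp => _ [pi [pi1 pi2] <-].
pose psi (S : borel_sub m0) : borel (@sphere R) := Psi w (set_val S).
have mpsi : measurable_fun setT psi.
  exact: (@continuous_borel_measurable (@pointed_at M m0) (@sphere R) psi
    (M_continuous w w0)).
have mpsi2 := measurable_prod_map mpsi mpsi.
pose X : {mfun (borel_sub m0 * borel_sub m0)%type
    >-> (borel (@sphere R) * borel (@sphere R))%type} :=
  HB.pack (fun S : borel_sub m0 * borel_sub m0 => (psi S.1, psi S.2))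
    (isMeasurableFun.Build _ _ _ _ _ mpsi2).
have mpre A : measurable A -> measurable (psi @^-1` A).
  by move=> mA; rewrite -[_ @^-1` _]setTI; exact: mpsi.
apply: le_trans.
  apply: ereal_inf_lbound; exists (distribution pi X) => //; split => A mA.
    (* The law on the sphere is by definition the image under [psi] of the law of the model, so the
       marginals of the image coupling are those of [pi] on preimages. *)
    rewrite -[RHS]/(distribution ftheta1 Phi1 (psi @^-1` A)) -pi1; last exact: mpre.
    by congr (pi _); apply/seteqP; split.
  rewrite -[RHS]/(distribution ftheta2 Phi2 (psi @^-1` A)) -pi2; last exact: mpre.
  by congr (pi _); apply/seteqP; split.
have q0 : 0 <= q by apply: le_trans q_ge1.
have mdq : measurable_fun setT (fun r : borel (@sphere R) * borel (@sphere R) =>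
    ((d_chord r.1 r.2) `^ q)%:E).
  apply/measurable_EFinP.
  exact: (measurableT_comp (measurable_powR q) (@measurable_d_chord R)).
(* On the left the integral may be enlarged to the whole space; on the model side the supports must
   be recovered, which takes their full measure. *)
apply: (@le_trans _ _ (\int[distribution pi X]_r ((d_chord r.1 r.2) `^ q)%:E)%E).
  by apply: ge0_le_integral_subset => // *; rewrite lee_fin powR_ge0.
rewrite ge0_integral_distribution//; last first.
  by move=> *; rewrite lee_fin powR_ge0.
set S1 := (supp _ : set M); set S2 := (supp _ : set M).
have mS1 : measurable (S1 : set (borel_sub m0)) by exact: msupp.
have mS2 : measurable (S2 : set (borel_sub m0)) by exact: msupp.
have mS : measurable (S1 `*` S2 : set (borel_sub m0 * borel_sub m0)).
  exact: measurableX.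
(* Outside the product one coordinate leaves its support, and each of these two events is null by
   the marginal conditions. *)
have SC0 : pi (~` (S1 `*` S2)) = 0.
  apply/eqP; rewrite eq_le measure_ge0 andbT.
  apply: (@le_trans _ _ (pi ((~` S1) `*` setT `|` setT `*` (~` S2)))).
    apply: le_measure; rewrite ?inE.
    - exact: measurableC.
    - by apply: measurableU; apply: measurableX => //; exact: measurableC.
    - by move=> [x y] /= /not_andP[]; [left|right].
  apply: le_trans (measureU2 _ _ _) _.
  - by apply: measurableX => //; exact: measurableC.
  - by apply: measurableX => //; exact: measurableC.
  have e1 : pi (~` S1 `*` setT) = 0.
    by rewrite pi1; [exact: suppC|exact: measurableC].
  have e2 : pi (setT `*` ~` S2) = 0.
    by rewrite pi2; [exact: suppC|exact: measurableC].
  rewrite [X in (X + _)%E](_ : _ = 0)//.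
  by rewrite [X in (_ + X)%E](_ : _ = 0) ?adde0.
rewrite (ge0_negligible_integral _ _ _ _ SC0)//; last 3 first.
- exact: measurableC.
- exact: measurableT_comp.
- by move=> *; rewrite lee_fin powR_ge0.
rewrite setTD setCK.
apply: ge0_le_integral_subset => //= [S _|S _|S _].
- by rewrite lee_fin powR_ge0.
- rewrite -poweR_EFin; apply: gt0_ler_poweR => //.
  + by rewrite in_itv/= lee_fin sqrtr_ge0 leey.
  + rewrite in_itv/= leey andbT.
    (* Monotonicity of the power needs a nonnegative gap; the bound at any frequency, here 0,
       provides it. *)
    apply: (le_trans _ (d_chord_le_gap 0 (M_RLinfty _ (set_valP S.1)) (M_RLinfty _ (set_valP S.2)))).
    by rewrite lee_fin sqrtr_ge0.
  + apply: d_chord_le_gap; apply: M_RLinfty; exact: set_valP.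
- exact: poweR_ge0.
Qed.
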